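(* Let $\phi : (M^2,g) \to (N^n,h)$ be a biharmonic map, and assume that $M$ is compact and that its biharmonic stress-energy tensor $S_2$ satisfies $\nabla S_2 =0$. Then $|\tau(\phi)|$ is constant and, moreover, $\int_{M} K^{M} \, v_g = 0$ or $S_2 = \frac{|\tau(\phi)|^2}{2} g$, where $K^M$ is the Gaussian curvature of $(M^2,g)$.
   Context: All objects are smooth; $(M^2,g)$ is a two-dimensional Riemannian manifold with volume element $v_g$, and $(N^n,h)$ is a Riemannian manifold. The curvature convention is $R(X,Y)=[\nabla_X,\nabla_Y]-\nabla_{[X,Y]}$. For a smooth map $\phi$, $\nabla$ also denotes the pull-back connection $\nabla^\phi$ on $\phi^{-1}TN$, and $\tau(\phi)=\mathrm{trace}\,\nabla d\phi$ is the tension field. The map $\phi$ is biharmonic if $\tau_2(\phi)=\mathrm{trace}(\nabla^\phi)^2\tau(\phi)-\mathrm{trace}\,R^N(d\phi(\cdot),\tau(\phi))d\phi(\cdot)=0$. The biharmonic stress-energy tensor is the symmetric $(0,2)$-tensor $$S_2(X,Y)=\Big\{\tfrac{|\tau(\phi)|^2}{2}+\langle d\phi,\nabla\tau(\phi)\rangle\Big\}g(X,Y)-\langle d\phi(X),\nabla_Y\tau(\phi)\rangle-\langle d\phi(Y),\nabla_X\tau(\phi)\rangle ,$$ with $\langle d\phi,\nabla\tau(\phi)\rangle=\sum_i\langle d\phi(X_i),\nabla_{X_i}\tau(\phi)\rangle$ for an orthonormal frame $\{X_i\}$.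
   Formalization: M is assumed to be connected; without this |τ(φ)| need not be constant (for example on a disjoint union of S²(1/√2) included in S³ and a sphere mapped to a point). *)

(* Defs.v *)
(* Tensors are represented classically: by their components in every chart.
   Points of coordinate space and component vectors are row vectors, and 'e_i
   is the i-th coordinate direction, so 'D_'e_i is the i-th partial derivative
   and 'D_'e_i f x, for f a map in coordinates, is the vector df(d/dx_i). *)
From HB Require Import structures.
From mathcomp Require Export all_boot all_order all_algebra.
From mathcomp Require Export all_classical all_reals all_analysis.

Set Implicit Arguments.
Unset Strict Implicit.
Unset Printing Implicit Defensive.

Export Order.TTheory GRing.Theory Num.Theory.
Export numFieldNormedType.Exports.

Local Open Scope classical_set_scope.
Local Open Scope ring_scope.

Section Smooth.
Variables (R : realType) (n : nat).
Implicit Types U : set 'rV[R]_n.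

Fixpoint Ck (k : nat) U (f : 'rV[R]_n -> R) : Prop :=
  (forall x, U x -> {for x, continuous f}) /\
  (if k is k'.+1 then
     forall i : 'I_n,
       (forall x, U x -> derivable f x 'e_i) /\ Ck k' U ('D_'e_i f)
   else True).

Definition smooth_on U (f : 'rV[R]_n -> R) := forall k, Ck k U f.

Definition smooth_map_on m U (f : 'rV[R]_n -> 'rV[R]_m) :=
  forall j : 'I_m, smooth_on U (fun x => f x ord0 j).

End Smooth.

(* Smooth n-manifolds without boundary, Hausdorff and second countable, but
   not necessarily connected; the atlas need not be maximal.  The base point
   carried by ptopologicalType, and the values of coord and param outside
   dom a and coord a @` dom a, are irrelevant. *)
Record manifold (R : realType) (n : nat) := Manifold {
  carrier :> ptopologicalType;
  chart : Type;
  dom : chart -> set carrier;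
  coord : chart -> carrier -> 'rV[R]_n;
  param : chart -> 'rV[R]_n -> carrier;
  chart_at : carrier -> chart;
  dom_chart_at : forall p, dom (chart_at p) p;
  dom_open : forall a, open (dom a);
  codom_open : forall a, open (coord a @` dom a);
  coordK : forall a p, dom a p -> param a (coord a p) = p;
  coord_continuous : forall a p, dom a p -> {for p, continuous (coord a)};
  param_continuous : forall a x, (coord a @` dom a) x ->
    {for x, continuous (param a)};
  transition_smooth : forall a b,
    smooth_map_on (coord a @` (dom a `&` dom b))
                  (fun x => coord b (param a x));
  manifold_hausdorff : hausdorff_space carrier;
  manifold_second_countable : @second_countable carrier
}.

Arguments chart {R n} M : rename.
Arguments dom {R n} M a : rename.
Arguments coord {R n} M a : rename.
Arguments param {R n} M a : rename.
Arguments chart_at {R n} M p : rename.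

Definition codom (R : realType) (n : nat) (M : manifold R n) (a : chart M)
  : set 'rV[R]_n := coord M a @` dom M a.

(* (i, k) entry: d(y_k)/d(x_i), for x the coordinates of a and y those of b *)
Definition transition_jacobian (R : realType) (n : nat) (M : manifold R n)
    (a b : chart M) (x : 'rV[R]_n) : 'M[R]_n :=
  \matrix_(i, k) ('D_'e_i (fun z => coord M b (param M a z)) x) ord0 k.

Record metric (R : realType) (n : nat) (M : manifold R n) := Metric {
  metric_mx :> chart M -> 'rV[R]_n -> 'M[R]_n;
  metric_smooth : forall a i j, smooth_on (codom a) (fun x => metric_mx a x i j);
  metric_sym : forall a x, codom a x -> (metric_mx a x)^T = metric_mx a x;
  metric_posdef : forall a x, codom a x -> forall v : 'rV[R]_n, v != 0 ->
    0 < (v *m metric_mx a x *m v^T) ord0 ord0;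
  metric_change : forall a b p, dom M a p -> dom M b p ->
    metric_mx a (coord M a p) =
      transition_jacobian a b (coord M a p) *m metric_mx b (coord M b p)
        *m (transition_jacobian a b (coord M a p))^T
}.

(* Riemannian geometry on an open set of coordinate space with metric G *)
Section Local.
Variables (R : realType) (n : nat) (G : 'rV[R]_n -> 'M[R]_n).
Implicit Types (x u v w : 'rV[R]_n) (i j k l : 'I_n).

Definition inner x u v : R := (u *m G x *m v^T) ord0 ord0.

Definition inv_metric x i j : R := invmx (G x) i j.

Definition christoffel k i j x : R :=
  2^-1 * \sum_l inv_metric x k l *
    ('D_'e_i (fun z => G z j l) x + 'D_'e_j (fun z => G z i l) x
     - 'D_'e_l (fun z => G z i j) x).

Definition christoffel_form x u v : 'rV[R]_n :=
  \row_k \sum_i \sum_j christoffel k i j x * u ord0 i * v ord0 j.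

(* the d/dx_l component of R(d/dx_i, d/dx_j) d/dx_k, for
   R(X,Y) = [nabla_X, nabla_Y] - nabla_[X,Y] *)
Definition riemann x i j k l : R :=
  'D_'e_i (christoffel l j k) x - 'D_'e_j (christoffel l i k) x
  + \sum_m (christoffel l i m x * christoffel m j k x
            - christoffel l j m x * christoffel m i k x).

Definition curvature x u v w : 'rV[R]_n :=
  \row_l \sum_i \sum_j \sum_k
    riemann x i j k l * u ord0 i * v ord0 j * w ord0 k.

(* (i, j) entry: (nabla_(d/dx_k) T)(d/dx_i, d/dx_j) *)
Definition nabla2 (T : 'rV[R]_n -> 'M[R]_n) k x : 'M[R]_n :=
  \matrix_(i, j) ('D_'e_k (fun z => T z i j) x
    - \sum_l christoffel l k i x * T x l j
    - \sum_l christoffel l k j x * T x i l).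

End Local.

Section LocalMap.
Variables (R : realType) (m n : nat).
Variables (G : 'rV[R]_m -> 'M[R]_m) (H : 'rV[R]_n -> 'M[R]_n).
Variable f : 'rV[R]_m -> 'rV[R]_n.
Implicit Types (x : 'rV[R]_m) (V : 'rV[R]_m -> 'rV[R]_n) (i j : 'I_m).

(* the pull-back connection: nabla_(d/dx_i) V for V a section along f *)
Definition nabla_pull i V x : 'rV[R]_n :=
  'D_'e_i V x + christoffel_form H (f x) ('D_'e_i f x) (V x).

Definition second_fundamental i j x : 'rV[R]_n :=
  nabla_pull i ('D_'e_j f) x - \sum_k christoffel G k i j x *: 'D_'e_k f x.

Definition tension x : 'rV[R]_n :=
  \sum_i \sum_j inv_metric G x i j *: second_fundamental i j x.

Definition hessian_section V i j x : 'rV[R]_n :=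
  nabla_pull i (nabla_pull j V) x
  - \sum_k christoffel G k i j x *: nabla_pull k V x.

Definition bitension x : 'rV[R]_n :=
  \sum_i \sum_j inv_metric G x i j *: hessian_section tension i j x
  - \sum_i \sum_j inv_metric G x i j *:
      curvature H (f x) ('D_'e_i f x) (tension x) ('D_'e_j f x).

Definition stress_bienergy_mx x : 'M[R]_m :=
  let B i j := inner H (f x) ('D_'e_i f x) (nabla_pull j tension x) in
  \matrix_(i, j)
    ((inner H (f x) (tension x) (tension x) / 2
      + \sum_k \sum_l inv_metric G x k l * B k l) * G x i j
     - B i j - B j i).

End LocalMap.

Section Maps.
Variables (R : realType) (m n : nat) (M : manifold R m) (N : manifold R n).
Variables (g : metric M) (h : metric N) (phi : M -> N).

Definition local_dom (a : chart M) (b : chart N) : set 'rV[R]_m :=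
  coord M a @` (dom M a `&` phi @^-1` dom N b).

Definition local_rep (a : chart M) (b : chart N) (x : 'rV[R]_m) : 'rV[R]_n :=
  coord N b (phi (param M a x)).

Definition smooth_map :=
  continuous phi /\
  forall a b, smooth_map_on (local_dom a b) (local_rep a b).

Definition biharmonic :=
  forall a b x, local_dom a b x ->
    bitension (g a) (h b) (local_rep a b) x = 0.

Definition tension_norm (p : M) : R :=
  let a := chart_at M p in
  let b := chart_at N (phi p) in
  let t := tension (g a) (h b) (local_rep a b) (coord M a p) in
  Num.sqrt (inner (h b) (coord N b (phi p)) t t).

(* components of S_2 in the chart a; the value at x is computed in any chart
   of N around phi(x) *)
Definition stress_bienergy (a : chart M) (x : 'rV[R]_m) : 'M[R]_m :=
  let b := chart_at N (phi (param M a x)) in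
  stress_bienergy_mx (g a) (h b) (local_rep a b) x.

End Maps.

Definition parallel (R : realType) (n : nat) (M : manifold R n) (g : metric M)
    (T : chart M -> 'rV[R]_n -> 'M[R]_n) :=
  forall a k x, codom a x -> nabla2 (g a) (T a) k x = 0.

Notation borel M := (g_sigma_algebraType (@open (carrier M))).

Section Surface.
Variables (R : realType) (M : manifold R 2) (g : metric M).

Definition gauss_curvature (p : M) : R :=
  let a := chart_at M p in
  let x := coord M a p in
  let X : 'rV[R]_2 := 'e_ord0 in
  let Y : 'rV[R]_2 := 'e_ord_max in
  inner (g a) x (curvature (g a) x X Y Y) X /
  (inner (g a) x X X * inner (g a) x Y Y - inner (g a) x X Y ^+ 2).

Definition row2 (z : R * R) : 'rV[R]_2 :=
  \row_(j < 2) (if j == ord0 then z.1 else z.2).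

(* The Riemannian measure v_g is the unique Borel measure equal to
   sqrt (det g) dx in every chart. *)
Definition riemannian_volume (v : set (borel M) -> \bar R) :=
  forall (a : chart M) (A : set (borel M)), measurable A -> A `<=` dom M a ->
    v A = (\int[lebesgue_measure \x lebesgue_measure]_(z in
             [set z | (coord M a @` A) (row2 z)])
               (Num.sqrt (\det (g a (row2 z))))%:E)%E.

End Surface.

(* Main.v *)
From HB Require Import structures.
Require Import Defs.
From mathcomp Require Import lra ring.

(** Let A be the endomorphism obtained from S_2 by raising an index, and K the
    Gaussian curvature.

    In dimension two the trace of A is |tau|^2, since the terms containing
    <dphi, nabla tau> cancel ([stress_trace_inner]).  As S_2 is parallel, the
    functions tr A and tr A^2 have zero derivative ([derive_raised]); as M is
    connected, they are constant.  In particular |tau| is constant.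

    The curvature annihilates every parallel tensor ([ricci_identity]), in
    particular S_2 and g.  On a surface, the curvature operator is K times the
    rotation by a right angle; so at a point where K is not zero, A commutes
    with the rotation and, being self-adjoint, is a multiple of the identity
    ([curvature_or_scalar]).  Then tr A^2 = (tr A)^2 / 2 at this point, hence
    everywhere by constancy.  By definiteness of g this equality means that the
    traceless part of A is zero ([traceless_part_zero]), which is the equation
    S_2 = |tau|^2 / 2 g.  If there is no such point, K is identically zero and
    so is its integral.

    Most of the work is to see that S_2, which is given by components, is a smooth
    tensor.  At a point x its components are computed in a chart of N around
    phi(x) which varies with x, so that derivatives of S_2 can be handled only
    once its components are known not to depend on that chart
    ([stress_target_change]).  Comparing the traces in different charts of M
    requires the transformation of S_2 under a change of coordinates in the
    source ([stress_source_change]).  Both follow from the transformation law of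
    the Levi-Civita connection ([conn_change]), itself deduced from the
    uniqueness of that connection ([conn_unique]).

    The calculus behind this is that of functions of class C^k defined by iterated
    partial derivatives: a function of class C^1 is differentiable
    ([C1_differentiable]), mixed partial derivatives commute ([schwarz]), and
    the classes C^k are closed under algebraic operations and composition
    ([Ck_comp]). *)

Set Implicit Arguments.
Unset Strict Implicit.
Unset Printing Implicit Defensive.

Local Open Scope classical_set_scope.
Local Open Scope ring_scope.

(** * Differentiability and mixed partial derivatives *)

Section Norm.
Variable R : realType.

Lemma ler_coord_norm n (h : 'rV[R]_n) i : `|h ord0 i| <= `|h|.
Proof.
rewrite [leRHS]/Num.Def.normr /= mx_normrE.
exact: (le_bigmax _ (fun ij => `|h ij.1 ij.2|) (ord0, i)).
Qed.

Lemma row_norm_le n (h : 'rV[R]_n) (c : R) :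
  0 <= c -> (forall i, `|h ord0 i| <= c) -> `|h| <= c.
Proof.
move=> c0 hc; rewrite [leLHS]/Num.Def.normr /= mx_normrE.
by apply: bigmax_le => // -[i j] _; rewrite ord1; exact: hc.
Qed.

Lemma norm_basis_le1 n (i : 'I_n) : `|'e_i : 'rV[R]_n| <= 1.
Proof.
apply: row_norm_le => // j; rewrite mxE eqxx /=.
by case: eqP => _; rewrite ?normr0 ?normr1.
Qed.

End Norm.

(** The differential is defined by choice among the linear maps with a little-o
   remainder, so one such map suffices. *)
Lemma differentiable_of_approx (R : numFieldType) (V W : normedModType R)
    (f : V -> W) (x : V) (df : {linear V -> W}) : continuous df ->
  (forall e : R, 0 < e ->
     \forall h \near (0 : V), `|f (h + x) - f x - df h| <= e * `|h|) ->
  differentiable f x.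
Proof.
move=> dfc approx.
have fE : f \o shift x = cst (f x) + df +o_ 0 id.
  apply/eqaddoP => e e0; near=> h.
  rewrite /= -[X in `|X| <= _]/(f (h + x) - (f x + df h)) opprD addrA.
  by near: h; exact: approx.
apply/diffP => /=.
apply: (@getPex _ (fun (df : {linear V -> W}) => continuous df /\
  forall y, f y = f (lim (nbhs x)) + df (y - lim (nbhs x))
                  +o_(y \near x) (y - lim (nbhs x)))).
exists df; split=> //; apply: eqaddoEx => z.
have /funeqP/(_ (z - x)) := fE; rewrite /= subrK => ->.
rewrite lim_id //; congr (_ + _).
rewrite [in RHS]littleo_center0 (comp_centerK x id).
by rewrite -[X in the_littleo _ _ _ X _ _ = _](comp_centerK x).
Unshelve. all: by end_near. Qed.

Section Line.
Variables (R : realType) (n : nat).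
Implicit Types (f : 'rV[R]_n -> R) (x z v : 'rV[R]_n).

Lemma is_derive_line f z v (t : R) : derivable f (t *: v + z) v ->
  is_derive t 1 (fun s => f (s *: v + z)) ('D_v f (t *: v + z)).
Proof.
have E : (fun h : R => h^-1 *: (f ((h *: 1 + t) *: v + z) - f (t *: v + z))) =
         (fun h : R => h^-1 *: (f (h *: v + (t *: v + z)) - f (t *: v + z))).
  by apply/funext => h; rewrite scalerDl addrA /GRing.scale /= mulr1.
move=> df; apply: DeriveDef.
  by rewrite /derivable; move: df; rewrite /derivable /= E.
by rewrite /derive /= E.
Qed.

(** The step [s] may be negative: it will be a coordinate of an increment. *)
Lemma MVT_line f z v (s : R) :
  (forall t, `|t| <= `|s| -> derivable f (t *: v + z) v) ->
  exists2 t, `|t| <= `|s| & f (s *: v + z) - f z = s * 'D_v f (t *: v + z).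
Proof.
move=> df.
have key a b : a <= b -> (forall t, t \in `[a, b] -> `|t| <= `|s|) ->
    exists2 t, t \in `[a, b] & f (b *: v + z) - f (a *: v + z) =
       'D_v f (t *: v + z) * (b - a).
  move=> ab sub.
  apply: (@MVT_segment R (fun t => f (t *: v + z)) (fun t => 'D_v f (t *: v + z))) => //.
    move=> x xab; apply: is_derive_line; apply: df; apply: sub.
    by move: xab; rewrite !in_itv /= => /andP[/ltW -> /ltW ->].
  apply: derivable_within_continuous => x xab.
  by have /is_derive_line[] := df _ (sub _ xab).
case: (leP 0 s) => s0.
  have [|t tin E] := key 0 s s0.
    move=> t; rewrite in_itv /= => /andP[t0 ts].
    by rewrite !ger0_norm.
  exists t; first by move: tin; rewrite in_itv /= => /andP[t0 ts]; rewrite !ger0_norm.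
  by move: E; rewrite scale0r add0r subr0 mulrC.
have [|t tin E] := key s 0 (ltW s0).
  move=> t; rewrite in_itv /= => /andP[ts t0].
  by rewrite ler0_norm // ltr0_norm // lerN2.
exists t.
  move: tin; rewrite in_itv /= => /andP[ts t0].
  by rewrite ler0_norm // ltr0_norm // lerN2.
move: E; rewrite scale0r add0r sub0r => E.
by rewrite -opprB E mulrN opprK mulrC.
Qed.

Lemma continuous_ball f x (e : R) : {for x, continuous f} -> 0 < e ->
  \forall y \near x, `|f y - f x| <= e.
Proof.
move=> /cvgrPdist_le fc e0; near=> y.
by rewrite distrC; near: y; exact: fc.
Unshelve. all: by end_near. Qed.

Lemma near_norm (P : set 'rV[R]_n) x : (\forall y \near x, P y) ->
  exists2 d : R, 0 < d & forall h, `|h| < d -> P (h + x).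
Proof.
move=> /nbhs_ballP[d /= d0 dP]; exists d => // h hd; apply: dP.
by rewrite -ball_normE /= opprD addrCA subrr addr0 normrN.
Qed.

(** The vertices of a path from [0] to [h] along the coordinate directions: on
   each edge a single partial derivative controls the function. *)
Definition truncated k (h : 'rV[R]_n) : 'rV[R]_n :=
  \row_(j < n) (if (j < k)%N then h ord0 j else 0).

Lemma truncatedS (i : 'I_n) h :
  truncated i.+1 h = h ord0 i *: 'e_i + truncated i h.
Proof.
apply/rowP => j; rewrite !mxE eqxx /=.
have [->|ji] := eqVneq j i; first by rewrite ltnS leqnn ltnn mulr1 addr0.
rewrite -val_eqE /= in ji.
by rewrite mulr0 add0r ltnS leq_eqVlt (negbTE ji).
Qed.

Lemma truncated0 h : truncated 0 h = 0.
Proof. by apply/rowP => j; rewrite !mxE ltn0. Qed.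

Lemma truncated_full h : truncated n h = h.
Proof. by apply/rowP => j; rewrite !mxE ltn_ord. Qed.

Lemma differentiable_of_linear_approx f x (A : 'I_n -> R) :
  (forall e : R, 0 < e ->
     \forall h \near (0 : 'rV[R]_n), `|f (h + x) - f x - \sum_i h ord0 i * A i| <= e * `|h|) ->
  differentiable f x.
Proof.
move=> approx; pose df (h : 'rV[R]_n) : R := \sum_i h ord0 i * A i.
have df_lin : linear df.
  move=> a u v; rewrite /df scaler_sumr -big_split /=; apply: eq_bigr => i _.
  by rewrite !mxE mulrDl scalerAl.
pose dfM := GRing.isLinear.Build _ _ _ _ _ df_lin.
pose dfL : {linear 'rV[R]_n -> R} := HB.pack df dfM.
have dfc : continuous dfL.
  move=> z; apply: differentiable_continuous.
  have -> : (dfL : _ -> _) = \sum_(i < n) (fun h : 'rV[R]_n => h ord0 i * A i).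
    by apply/funext => h; rewrite fct_sumE.
  apply: differentiable_sum => i.
  by apply: differentiableM => //; exact: differentiable_coord.
exact: (@differentiable_of_approx R 'rV[R]_n R f x dfL dfc approx).
Qed.

(** Along the path of the [truncated k h], the mean value theorem turns each
   increment of [f] into [h_i] times the i-th partial derivative at a nearby
   point, which continuity replaces by its value at [x]. *)
Lemma C1_differentiable f x :
  (\forall y \near x, forall i : 'I_n, derivable f y 'e_i) ->
  (forall i : 'I_n, {for x, continuous ('D_'e_i f)}) ->
  differentiable f x.
Proof.
move=> df cf; apply: (@differentiable_of_linear_approx _ _ (fun i => 'D_'e_i f x)).
move=> e e0.
(* there are n edges; n + 1 also covers dimension 0 *)
pose c := e / n.+1%:R.
have c0 : 0 < c by rewrite divr_gt0.
have : \forall y \near x, (forall i : 'I_n, derivable f y 'e_i) /\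
    (forall i : 'I_n, `|'D_'e_i f y - 'D_'e_i f x| <= c).
  near=> y; split; first by near: y.
  move=> i; move: i; near: y; apply: filter_forall => i.
  exact: continuous_ball.
move=> /near_norm[d d0 dP].
near=> h.
have hd : `|h| < d by near: h; exact: (@nbhs0_lt R 'rV[R]_n).
have step k : (k <= n)%N ->
    `|f (truncated k h + x) - f x - \sum_(i < n | (i < k)%N) h ord0 i * 'D_'e_i f x|
      <= k%:R * c * `|h|.
  elim: k => [_|k IH kn].
    by rewrite truncated0 add0r big_pred0 // subrr subr0 normr0 !mul0r.
  pose i := Ordinal kn.
  have bd (t : R) : `|t| <= `|h ord0 i| -> `|t *: 'e_i + truncated k h| <= `|h|.
    move=> th; apply: row_norm_le => // j; rewrite !mxE eqxx /=.
    have [->|ji] := eqVneq j i.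
      rewrite /= ltnn mulr1 addr0; apply: le_trans th _; exact: ler_coord_norm.
    rewrite mulr0 add0r; case: ifP => _; rewrite ?normr0 //; exact: ler_coord_norm.
  have [|t th E] := @MVT_line f (truncated k h + x) 'e_i (h ord0 i).
    move=> t th; rewrite addrA.
    by have [] := dP _ (le_lt_trans (bd _ th) hd).
  have -> : truncated k.+1 h = h ord0 i *: 'e_i + truncated k h by exact: (truncatedS i).
  rewrite -[_ + _ + x]addrA (bigD1 i) //=.
  rewrite (eq_bigl (fun j : 'I_n => (j < k)%N)); last first.
    move=> j /=; rewrite ltnS -val_eqE /= andbC ltn_neqAle; by case: eqP.
  set S := \sum_(j < n | _) _; have {}IH := IH (ltnW kn); rewrite -/S in IH.
  have -> : f (h ord0 i *: 'e_i + (truncated k h + x)) - f x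
      - (h ord0 i * 'D_'e_i f x + S) =
      h ord0 i * ('D_'e_i f (t *: 'e_i + (truncated k h + x)) - 'D_'e_i f x)
      + (f (truncated k h + x) - f x - S).
    by rewrite mulrBr -E; ring.
  apply: le_trans (ler_normD _ _) _.
  rewrite -natr1 mulrDl mulrDl mul1r addrC; apply: lerD => //.
  rewrite normrM mulrC ler_pM //; last exact: ler_coord_norm.
  rewrite addrA.
  by have [_] := dP _ (le_lt_trans (bd _ th) hd).
have := step n (leqnn n); rewrite truncated_full.
rewrite (eq_bigl xpredT); last by move=> i; rewrite ltn_ord.
move=> /le_trans; apply; rewrite ler_wpM2r // /c mulrA.
by rewrite ler_pdivrMr // mulrC ler_pM2l // ler_nat.
Unshelve. all: by end_near. Qed.

Lemma dist_le_of_common (p q r e : R) :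
  `|r - p| <= e / 2 -> `|r - q| <= e / 2 -> `|p - q| <= e.
Proof.
by rewrite !ler_norml => /andP[p1 p2] /andP[q1 q2]; apply/andP; split; lra.
Qed.

(** The second difference of [f] over a small square is symmetric in the two
   directions, and two applications of the mean value theorem show that it is
   the square of the side times a value of either mixed derivative. *)
Lemma schwarz f x (i j : 'I_n) :
  (\forall y \near x, [/\ derivable f y 'e_i, derivable f y 'e_j,
     derivable ('D_'e_i f) y 'e_j & derivable ('D_'e_j f) y 'e_i]) ->
  {for x, continuous ('D_'e_j ('D_'e_i f))} ->
  {for x, continuous ('D_'e_i ('D_'e_j f))} ->
  'D_'e_j ('D_'e_i f) x = 'D_'e_i ('D_'e_j f) x.
Proof.
have quotient (a b : 'I_n) (d s : R) : 0 < d -> `|s| * 2 < d ->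
    (forall h, `|h| < d -> derivable f (h + x) 'e_a /\ derivable ('D_'e_a f) (h + x) 'e_b) ->
    exists2 h, `|h| < d & f (s *: 'e_a + (s *: 'e_b + x)) - f (s *: 'e_b + x)
       - f (s *: 'e_a + x) + f x = s * (s * 'D_'e_b ('D_'e_a f) (h + x)).
  move=> d0 sd dP.
  have bd (t u : R) (k l : 'I_n) : `|t| <= `|s| -> `|u| <= `|s| ->
     `|t *: 'e_k + u *: 'e_l : 'rV[R]_n| < d.
    move=> ts us; apply: le_lt_trans sd; rewrite mulr_natr mulr2n.
    have le_s (r : R) m : `|r| <= `|s| -> `|r *: 'e_m : 'rV[R]_n| <= `|s|.
      by rewrite normrZ; apply: le_trans; rewrite ler_piMr // norm_basis_le1.
    by apply: le_trans (ler_normD _ _) _; apply: lerD; exact: le_s.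
  have bd1 (t : R) (k : 'I_n) : `|t| <= `|s| -> `|t *: 'e_k : 'rV[R]_n| < d.
    by move=> ts; have := bd t 0 k k ts; rewrite scale0r addr0 normr0; apply.
  pose F z := f (s *: 'e_b + z) - f z.
  have dF (t : R) : `|t| <= `|s| -> derivable F (t *: 'e_a + x) 'e_a /\
      'D_'e_a F (t *: 'e_a + x) = 'D_'e_a f (s *: 'e_b + (t *: 'e_a + x))
        - 'D_'e_a f (t *: 'e_a + x).
    move=> ts.
    have [d1 _] := dP _ (bd1 t a ts).
    have [] := dP _ (bd s t b a (lexx _) ts); rewrite -addrA => d2 _.
    have shiftE : (fun h : R => h^-1 *: (f (s *: 'e_b + (h *: 'e_a + (t *: 'e_a + x)))
                - f (s *: 'e_b + (t *: 'e_a + x)))) =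
       (fun h : R => h^-1 *: (f (h *: 'e_a + (s *: 'e_b + (t *: 'e_a + x)))
                - f (s *: 'e_b + (t *: 'e_a + x)))).
      by apply/funext => h; rewrite addrCA.
    have d3 : derivable (fun z => f (s *: 'e_b + z)) (t *: 'e_a + x) 'e_a.
      by rewrite /derivable /= shiftE.
    pose Fb z := f (s *: 'e_b + z).
    split; first exact: (@derivableB R 'rV[R]_n R Fb f _ _ d3 d1).
    have -> : 'D_'e_a F (t *: 'e_a + x) = 'D_'e_a Fb (t *: 'e_a + x) - 'D_'e_a f (t *: 'e_a + x).
      exact: (@deriveB R 'rV[R]_n R Fb f _ _ d3 d1).
    by rewrite {1}/derive /= shiftE.
  have [|t ts E] := @MVT_line F x 'e_a s; first by move=> t /dF[].
  have [_ E2] := dF _ ts; rewrite {}E2 in E.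
  have [|u us E3] := @MVT_line ('D_'e_a f) (t *: 'e_a + x) 'e_b s.
    by move=> u us; rewrite addrA; have [] := dP _ (bd u t b a us ts).
  exists (u *: 'e_b + t *: 'e_a); first exact: bd.
  rewrite -[_ + _ + x]addrA -E3 -E /F [s *: 'e_b + (s *: 'e_a + _)]addrCA.
  by ring.
move=> df ci cj; apply/eqP; rewrite -subr_eq0 -normr_le0; apply/ler_addgt0Pr => e e0.
rewrite add0r.
have e20 : 0 < e / 2 by rewrite divr_gt0.
have [d d0 dP] := near_norm (filterI df
  (filterI (continuous_ball ci e20) (continuous_ball cj e20))).
(* both intermediate points are within 2 s of x *)
pose s := d / 4.
have s0 : 0 < s by rewrite divr_gt0.
have sd : `|s| * 2 < d by rewrite gtr0_norm // /s; lra.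
have [|h1 hd1 E1] := quotient i j d s d0 sd; first by move=> h /dP[[]].
have [|h2 hd2 E2] := quotient j i d s d0 sd; first by move=> h /dP[[]].
have [_ [c1 _]] := dP _ hd1; have [_ [_ c2]] := dP _ hd2.
have swap : s *: 'e_i + (s *: 'e_j + x) = s *: 'e_j + (s *: 'e_i + x) by rewrite addrCA.
have E' : s * (s * 'D_'e_j ('D_'e_i f) (h1 + x)) = s * (s * 'D_'e_i ('D_'e_j f) (h2 + x)).
  have cancel_eq (p q r t u v : R) :
    p - q - r + t = u -> p - r - q + t = v -> u = v by move=> <- <-; ring.
  rewrite swap in E1; exact: cancel_eq E1 E2.
have E := mulfI (lt0r_neq0 s0) (mulfI (lt0r_neq0 s0) E').
rewrite E in c1; exact: dist_le_of_common c1 c2.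
Qed.

End Line.

(** * Derivatives of matrix-valued maps *)

Section Derivation.
Variable R : realType.

Lemma differentiable_mx (V : normedModType R) p q (A : V -> 'M[R]_(p, q)) x :
  (forall i j, differentiable (fun y => A y i j) x) -> differentiable A x.
Proof.
move=> dA.
have -> : A = \sum_(i < p) \sum_(j < q) (fun y => A y i j *: delta_mx i j).
  apply/funext => y; rewrite [LHS]matrix_sum_delta fct_sumE.
  by apply: eq_bigr => i _; rewrite fct_sumE.
apply: differentiable_sum => i; apply: differentiable_sum => j.
exact: differentiableZl.
Qed.

Lemma derive_comp (V1 V2 W : normedModType R) (F : V1 -> V2) (f : V2 -> W) x v :
  differentiable F x -> differentiable f (F x) ->
  'D_v (fun y => f (F y)) x = 'D_('D_v F x) f (F x).
Proof.
move=> dF df; have dfF : differentiable (f \o F) x by exact: differentiable_comp.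
by rewrite (deriveE v dfF) (deriveE _ df) (deriveE v dF) diff_comp.
Qed.

Lemma derive_dir n (W : normedModType R) (f : 'rV[R]_n -> W) x v :
  differentiable f x -> 'D_v f x = \sum_j v ord0 j *: 'D_'e_j f x.
Proof.
move=> df; rewrite (deriveE v df) {1}[v]row_sum_delta linear_sum.
by apply: eq_bigr => j _; rewrite linearZ (deriveE _ df).
Qed.

Lemma derive_mxE (V : normedModType R) p q (A : V -> 'M[R]_(p, q)) x v i j :
  differentiable A x -> ('D_v A x) i j = 'D_v (fun y => A y i j) x.
Proof. by move=> dA; rewrite derive_mx ?mxE //; exact: diff_derivable. Qed.

Lemma differentiable_entry (V : normedModType R) p q (A : V -> 'M[R]_(p, q)) x i j :
  differentiable A x -> differentiable (fun y => A y i j) x.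
Proof.
move=> dA; apply: (@differentiable_comp _ _ _ _ A (fun B : 'M[R]_(p, q) => B i j)) => //.
exact: differentiable_coord.
Qed.

Lemma derive_sum_fun (V W : normedModType R) p (f : 'I_p -> V -> W) x v :
  (forall i, differentiable (f i) x) ->
  'D_v (fun y => \sum_i f i y) x = \sum_i 'D_v (f i) x.
Proof.
move=> df; rewrite (_ : (fun y => _) = \sum_i f i).
  by rewrite derive_sum // => i; exact: diff_derivable.
by apply/funext => y; rewrite fct_sumE.
Qed.

Lemma differentiable_sum_fun (V W : normedModType R) p (f : 'I_p -> V -> W) x :
  (forall i, differentiable (f i) x) -> differentiable (fun y => \sum_i f i y) x.
Proof.
move=> df; rewrite (_ : (fun y => _) = \sum_i f i); first exact: differentiable_sum.
by apply/funext => y; rewrite fct_sumE.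
Qed.

Lemma differentiable_mulmx (V : normedModType R) p q r
    (A : V -> 'M[R]_(p, q)) (B : V -> 'M[R]_(q, r)) x :
  differentiable A x -> differentiable B x ->
  differentiable (fun y => A y *m B y) x.
Proof.
move=> dA dB; apply: differentiable_mx => i j.
rewrite (_ : (fun y => _) = fun y => \sum_k A y i k * B y k j); last first.
  by apply/funext => y; rewrite mxE.
apply: differentiable_sum_fun => k.
by apply: differentiableM; exact: differentiable_entry.
Qed.

Lemma derive_mulmx (V : normedModType R) p q r
    (A : V -> 'M[R]_(p, q)) (B : V -> 'M[R]_(q, r)) x v :
  differentiable A x -> differentiable B x ->
  'D_v (fun y => A y *m B y) x = 'D_v A x *m B x + A x *m 'D_v B x.
Proof.
move=> dA dB; apply/matrixP => i j.
rewrite derive_mxE; last exact: differentiable_mulmx.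
rewrite (_ : (fun y => _) = fun y => \sum_k A y i k * B y k j); last first.
  by apply/funext => y; rewrite mxE.
have dAe k : differentiable (fun y => A y i k) x by exact: differentiable_entry.
have dBe k : differentiable (fun y => B y k j) x by exact: differentiable_entry.
rewrite derive_sum_fun; last by move=> k; exact: differentiableM.
rewrite !mxE -big_split /=; apply: eq_bigr => k _.
rewrite !derive_mxE // [LHS](deriveM (diff_derivable (dAe k)) (diff_derivable (dBe k))).
by rewrite addrC; congr (_ + _); exact: mulrC.
Qed.

Lemma differentiable_trmx (V : normedModType R) p q (A : V -> 'M[R]_(p, q)) x :
  differentiable A x -> differentiable (fun y => (A y)^T) x.
Proof.
move=> dA; apply: differentiable_mx => i j.
rewrite (_ : (fun y => _) = fun y => A y j i); first exact: differentiable_entry.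
by apply/funext => y; rewrite mxE.
Qed.

Lemma derive_trmx (V : normedModType R) p q (A : V -> 'M[R]_(p, q)) x v :
  differentiable A x -> 'D_v (fun y => (A y)^T) x = ('D_v A x)^T.
Proof.
move=> dA; apply/matrixP => i j; rewrite derive_mxE; last exact: differentiable_trmx.
rewrite mxE derive_mxE //; congr ('D_v _ x).
by apply/funext => y; rewrite mxE.
Qed.

(** Components of tensors are prescribed on open sets only, so an identity between
   them can be differentiated by this lemma and not by functional
   extensionality. *)
Lemma derive_open_eq (V W : normedModType R) (U : set V) (f g : V -> W) x v :
  open U -> (forall y, U y -> f y = g y) -> U x -> 'D_v f x = 'D_v g x.
Proof.
move=> oU fg Ux; apply: near_eq_derive.
by move: (open_nbhs_nbhs (conj oU Ux)); apply: filterS.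
Qed.

Lemma derivable_open_eq (V W : normedModType R) (U : set V) (f g : V -> W) x v :
  open U -> (forall y, U y -> f y = g y) -> U x -> derivable f x v -> derivable g x v.
Proof.
move=> oU fg Ux; apply: near_eq_derivable.
by move: (open_nbhs_nbhs (conj oU Ux)); apply: filterS.
Qed.

Lemma continuous_open_eq (V W : topologicalType) (U : set V) (f g : V -> W) x :
  open U -> (forall y, U y -> f y = g y) -> U x ->
  {for x, continuous f} -> {for x, continuous g}.
Proof.
move=> oU fg Ux fc; have E : f y @[y --> x] --> g x by rewrite -(fg _ Ux); exact: fc.
apply: cvg_trans E; apply: near_eq_cvg.
by move: (open_nbhs_nbhs (conj oU Ux)); apply: filterS => y Uy; rewrite fg.
Qed.

End Derivation.

(** * Closure properties of smooth functions *)

Section CkClosure.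
Variables (R : realType) (m : nat).
Implicit Types (U : set 'rV[R]_m) (f g : 'rV[R]_m -> R) (k : nat).

Lemma Ck_continuous k U f x : Ck k U f -> U x -> {for x, continuous f}.
Proof. by case: k => [|k] [fc _] Ux; exact: fc. Qed.

Lemma Ck_derive k U f i : Ck k.+1 U f -> Ck k U ('D_'e_i f).
Proof. by move=> [_ /(_ i)[]]. Qed.

Lemma CkW k U f : Ck k.+1 U f -> Ck k U f.
Proof.
elim: k f => [|k IH] f [fc fd]; split=> // i.
by have [fi ki] := fd i; split=> //; exact: IH.
Qed.

Lemma Ck_sub k U U' f : U' `<=` U -> Ck k U f -> Ck k U' f.
Proof.
move=> sU; elim: k f => [|k IH] f [fc fd];
  (split; first by move=> x /sU; exact: fc) => // i.
have [fi ki] := fd i; split; last exact: IH.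
by move=> x /sU; exact: fi.
Qed.

Lemma Ck_differentiable k U f x : open U -> Ck k.+1 U f -> U x -> differentiable f x.
Proof.
move=> oU fk Ux; apply: C1_differentiable.
  move: (open_nbhs_nbhs (conj oU Ux)); apply: filterS => y Uy i.
  by have [_ /(_ i)[fi _]] := fk; exact: fi.
by move=> i; exact: Ck_continuous (Ck_derive i fk) Ux.
Qed.

Lemma CkS k U f : (forall x, U x -> differentiable f x) ->
  (forall i, Ck k U ('D_'e_i f)) -> Ck k.+1 U f.
Proof.
move=> fd fk; split=> [x Ux|i]; first exact/differentiable_continuous/fd.
by split=> // x Ux; exact/diff_derivable/fd.
Qed.

Lemma Ck_eq k U f g : open U -> (forall x, U x -> f x = g x) -> Ck k U f -> Ck k U g.
Proof.
move=> oU; elim: k f g => [|k IH] f g fg [fc fd];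
  (split; first by move=> x Ux; exact: (continuous_open_eq oU fg Ux (fc x Ux))) => // i.
have [fi ki] := fd i; split=> [x Ux|].
  exact: derivable_open_eq oU fg Ux (fi x Ux).
by apply: IH ki => x Ux; exact: derive_open_eq oU fg Ux.
Qed.

Lemma Ck_cst k U (c : R) : open U -> Ck k U (fun=> c).
Proof.
move=> oU; elim: k c => [|k IH] c; first by split=> // x _; exact: cst_continuous.
apply: CkS => [x _|i]; first exact: differentiable_cst.
by apply: (Ck_eq oU _ (IH 0)) => x _; rewrite derive_cst.
Qed.

Lemma CkD k U f g : open U -> Ck k U f -> Ck k U g -> Ck k U (fun x => f x + g x).
Proof.
move=> oU; elim: k f g => [|k IH] f g fk gk.
  split=> // x Ux; apply: (@continuousD _ R _ f g).
    exact: Ck_continuous fk Ux.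
  exact: Ck_continuous gk Ux.
have fd x Ux : differentiable f x := Ck_differentiable oU fk Ux.
have gd x Ux : differentiable g x := Ck_differentiable oU gk Ux.
apply: CkS => [x Ux|i]; first exact: (differentiableD (fd x Ux) (gd x Ux)).
apply: (Ck_eq oU _ (IH _ _ (Ck_derive i fk) (Ck_derive i gk))) => x Ux.
by rewrite (deriveD (diff_derivable (fd x Ux)) (diff_derivable (gd x Ux))).
Qed.

Lemma CkM k U f g : open U -> Ck k U f -> Ck k U g -> Ck k U (fun x => f x * g x).
Proof.
move=> oU; elim: k f g => [|k IH] f g fk gk.
  split=> // x Ux; apply: (@continuousM R _ f g).
    exact: Ck_continuous fk Ux.
  exact: Ck_continuous gk Ux.
have fd x Ux : differentiable f x := Ck_differentiable oU fk Ux.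
have gd x Ux : differentiable g x := Ck_differentiable oU gk Ux.
apply: CkS => [x Ux|i]; first exact: (differentiableM (fd x Ux) (gd x Ux)).
apply: (Ck_eq oU _ (CkD oU (IH _ _ (CkW fk) (Ck_derive i gk))
                           (IH _ _ (CkW gk) (Ck_derive i fk)))) => x Ux.
by rewrite (deriveM (diff_derivable (fd x Ux)) (diff_derivable (gd x Ux))).
Qed.

Lemma CkV k U f : open U -> (forall x, U x -> f x != 0) -> Ck k U f ->
  Ck k U (fun x => (f x)^-1).
Proof.
move=> oU f0; elim: k => [|k IH] fk.
  by split=> // x Ux; apply: (@continuousV R _ f); [exact: f0|exact: Ck_continuous fk Ux].
have fd x Ux : differentiable f x := Ck_differentiable oU fk Ux.
apply: CkS => [x Ux|i]; first exact: (differentiableV (fd x Ux) (f0 x Ux)).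
have vk := IH (CkW fk).
apply: (Ck_eq oU _ (CkM oU (CkM oU (Ck_cst k (-1) oU) (CkM oU vk vk)) (Ck_derive i fk))) => x Ux.
rewrite (deriveV (f0 x Ux) (diff_derivable (fd x Ux))) mulN1r.
by rewrite -invfM -expr2.
Qed.

End CkClosure.

(** By the chain rule, a partial derivative of the composite is a sum of products
   of functions of class [k], the outer factor being again a composite: hence
   the induction on [k] for all [f] at once. *)
Lemma Ck_comp (R : realType) m p k (U : set 'rV[R]_m) (V : set 'rV[R]_p)
    (F : 'rV[R]_m -> 'rV[R]_p) (f : 'rV[R]_p -> R) : open U -> open V ->
  (forall x, U x -> V (F x)) -> (forall j, Ck k U (fun x => F x ord0 j)) -> Ck k V f ->
  Ck k U (fun x => f (F x)).
Proof.
move=> oU oV UV; elim: k f => [|k IH] f Fk fk.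
  split=> // x Ux.
  have Fc : {for x, continuous F}.
    apply/(@cvgrPdist_le _ _ _ (nbhs x)) => e e0.
    have Fe : \forall y \near x, forall j, `|F y ord0 j - F x ord0 j| <= e.
      near=> y; move=> j; move: j; near: y; apply: filter_forall => j.
      exact: (@continuous_ball _ _ (fun y => F y ord0 j) x e (Ck_continuous (Fk j) Ux) e0).
    apply: (@filterS _ (nbhs x) _ _ _ _ Fe) => y Fy.
    apply: row_norm_le; first exact: ltW.
    by move=> j; rewrite !mxE distrC.
  exact: (continuous_comp Fc (Ck_continuous fk (UV x Ux))).
have Fd x : U x -> differentiable F x.
  move=> Ux; apply: differentiable_mx => i j; rewrite ord1.
  exact: Ck_differentiable oU (Fk j) Ux.
have fd x : V x -> differentiable f x by move=> Vx; exact: Ck_differentiable oV fk Vx.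
apply: CkS => [x Ux|i]; first exact: (differentiable_comp (Fd x Ux) (fd _ (UV x Ux))).
pose S x := \sum_j 'D_'e_i (fun x => F x ord0 j) x * 'D_'e_j f (F x).
have Sk : Ck k U S.
  rewrite /S; elim: (index_enum _) => [|j s IHs].
    by apply: (Ck_eq oU _ (Ck_cst k 0 oU)) => x _; rewrite big_nil.
  have ks : Ck k U (fun x => 'D_'e_i (fun x => F x ord0 j) x * 'D_'e_j f (F x) +
      \sum_(l <- s) 'D_'e_i (fun x => F x ord0 l) x * 'D_'e_l f (F x)).
    apply: (CkD oU _ IHs); apply: (CkM oU (Ck_derive i (Fk j))).
    by apply: IH (Ck_derive j fk) => l; exact: CkW.
  by apply: (Ck_eq oU _ ks) => x _; rewrite big_cons.
apply: (Ck_eq oU _ Sk) => x Ux.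
rewrite derive_comp; [|exact: Fd|exact/fd/UV].
rewrite derive_dir; last exact/fd/UV.
by apply: eq_bigr => j _; rewrite derive_mxE //; exact: Fd.
Unshelve. all: by end_near. Qed.

Section SmoothClosure.
Variables (R : realType) (m : nat) (U : set 'rV[R]_m).
Hypothesis oU : open U.
Implicit Types f g : 'rV[R]_m -> R.

Lemma smooth_differentiable f x : smooth_on U f -> U x -> differentiable f x.
Proof. by move=> fs; exact: Ck_differentiable oU (fs 1). Qed.

Lemma smooth_eq f g : (forall x, U x -> f x = g x) -> smooth_on U f -> smooth_on U g.
Proof. by move=> fg fs k; exact: Ck_eq oU fg (fs k). Qed.

Lemma smooth_derive f i : smooth_on U f -> smooth_on U ('D_'e_i f).
Proof. by move=> fs k; exact: Ck_derive (fs k.+1). Qed.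

Lemma smooth_cst (c : R) : smooth_on U (fun=> c).
Proof. by move=> k; exact: Ck_cst. Qed.

Lemma smoothD f g : smooth_on U f -> smooth_on U g -> smooth_on U (fun x => f x + g x).
Proof. by move=> fs gs k; exact: CkD. Qed.

Lemma smoothM f g : smooth_on U f -> smooth_on U g -> smooth_on U (fun x => f x * g x).
Proof. by move=> fs gs k; exact: CkM. Qed.

Lemma smoothV f : (forall x, U x -> f x != 0) -> smooth_on U f ->
  smooth_on U (fun x => (f x)^-1).
Proof. by move=> f0 fs k; exact: CkV. Qed.

Lemma smooth_sum I (s : seq I) (P : pred I) (F : I -> 'rV[R]_m -> R) :
  (forall i, smooth_on U (F i)) -> smooth_on U (fun x => \sum_(i <- s | P i) F i x).
Proof.
move=> Fs; elim: s => [|i s IH].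
  by apply: (smooth_eq _ (smooth_cst 0)) => x _; rewrite big_nil.
case: (boolP (P i)) => Pi.
  by apply: (smooth_eq _ (smoothD (Fs i) IH)) => x _; rewrite big_cons Pi.
by apply: (smooth_eq _ IH) => x _; rewrite big_cons (negbTE Pi).
Qed.

Lemma smooth_prod I (s : seq I) (P : pred I) (F : I -> 'rV[R]_m -> R) :
  (forall i, smooth_on U (F i)) -> smooth_on U (fun x => \prod_(i <- s | P i) F i x).
Proof.
move=> Fs; elim: s => [|i s IH].
  by apply: (smooth_eq _ (smooth_cst 1)) => x _; rewrite big_nil.
case: (boolP (P i)) => Pi.
  by apply: (smooth_eq _ (smoothM (Fs i) IH)) => x _; rewrite big_cons Pi.
by apply: (smooth_eq _ IH) => x _; rewrite big_cons (negbTE Pi).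
Qed.

Lemma smooth_schwarz f i j x : smooth_on U f -> U x ->
  'D_'e_j ('D_'e_i f) x = 'D_'e_i ('D_'e_j f) x.
Proof.
move=> fs Ux.
have cD k l : {for x, continuous ('D_'e_k ('D_'e_l f))}.
  exact: Ck_continuous (smooth_derive k (smooth_derive l fs) 0) Ux.
apply: schwarz => //.
apply: (@filterS _ (nbhs x) _ _ _ _ (open_nbhs_nbhs (conj oU Ux))) => y Uy.
by split; apply: diff_derivable; apply: smooth_differentiable => //; exact: smooth_derive.
Qed.

Definition smooth_mx p q (A : 'rV[R]_m -> 'M[R]_(p, q)) :=
  forall i j, smooth_on U (fun x => A x i j).

Lemma smooth_mx_row p (F : 'rV[R]_m -> 'rV[R]_p) : smooth_map_on U F <-> smooth_mx F.
Proof. by split=> Fs; [move=> i j; rewrite ord1|move=> j]; exact: Fs. Qed.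

Section Matrices.
Variables p q r : nat.
Implicit Types (A B : 'rV[R]_m -> 'M[R]_(p, q)) (C : 'rV[R]_m -> 'M[R]_(q, r)).

Lemma smooth_mx_differentiable A x : smooth_mx A -> U x -> differentiable A x.
Proof.
by move=> As Ux; apply: differentiable_mx => i j; exact: smooth_differentiable (As i j) Ux.
Qed.

Lemma smooth_mx_eq A B : (forall x, U x -> A x = B x) -> smooth_mx A -> smooth_mx B.
Proof. by move=> AB As i j; apply: smooth_eq (As i j) => x Ux; rewrite AB. Qed.

Lemma smooth_mx_derive A i : smooth_mx A -> smooth_mx ('D_'e_i A).
Proof.
move=> As k l; apply: (smooth_eq _ (smooth_derive i (As k l))) => x Ux.
by rewrite derive_mxE //; exact: smooth_mx_differentiable.
Qed.

Lemma smooth_mxD A B : smooth_mx A -> smooth_mx B -> smooth_mx (fun x => A x + B x).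
Proof.
by move=> As Bs i j; apply: (smooth_eq _ (smoothD (As i j) (Bs i j))) => x _; rewrite mxE.
Qed.

Lemma smooth_mxZ f A : smooth_on U f -> smooth_mx A -> smooth_mx (fun x => f x *: A x).
Proof.
by move=> fs As i j; apply: (smooth_eq _ (smoothM fs (As i j))) => x _; rewrite mxE.
Qed.

Lemma smooth_mxN A : smooth_mx A -> smooth_mx (fun x => - A x).
Proof.
move=> As; apply: (smooth_mx_eq _ (smooth_mxZ (smooth_cst (-1)) As)) => x _.
by rewrite scaleN1r.
Qed.

Lemma smooth_mxM A C : smooth_mx A -> smooth_mx C -> smooth_mx (fun x => A x *m C x).
Proof.
move=> As Cs i j.
apply: (smooth_eq (f := fun x => \sum_k A x i k * C x k j)); first by move=> x _; rewrite mxE.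
by apply: smooth_sum => k; exact: smoothM.
Qed.

Lemma smooth_mxT A : smooth_mx A -> smooth_mx (fun x => (A x)^T).
Proof. by move=> As i j; apply: (smooth_eq _ (As j i)) => x _; rewrite mxE. Qed.

Lemma smooth_mx_sum I (s : seq I) (P : pred I) (F : I -> 'rV[R]_m -> 'M[R]_(p, q)) :
  (forall i, smooth_mx (F i)) -> smooth_mx (fun x => \sum_(i <- s | P i) F i x).
Proof.
move=> Fs k l; apply: (smooth_eq _ (smooth_sum s P (fun i => Fs i k l))) => x _.
by rewrite summxE.
Qed.

Lemma smooth_mx_schwarz A i j x : smooth_mx A -> U x ->
  'D_'e_j ('D_'e_i A) x = 'D_'e_i ('D_'e_j A) x.
Proof.
move=> As Ux; apply/matrixP => k l.
have E a : forall y, U y -> ('D_'e_a A) y k l = 'D_'e_a (fun y => A y k l) y.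
  by move=> y Uy; rewrite derive_mxE //; exact: smooth_mx_differentiable.
have dD a : differentiable ('D_'e_a A) x.
  exact: smooth_mx_differentiable (smooth_mx_derive a As) Ux.
have mixed a b : ('D_'e_b ('D_'e_a A) x) k l = 'D_'e_b ('D_'e_a (fun y => A y k l)) x.
  apply: etrans (derive_mxE 'e_b k l (dD a)) _.
  exact: derive_open_eq oU (E a) Ux.
apply: etrans (mixed i j) _; apply: etrans (esym (mixed j i)).
exact: smooth_schwarz (As k l) Ux.
Qed.

End Matrices.

Lemma smooth_det p (A : 'rV[R]_m -> 'M[R]_p) : smooth_mx A -> smooth_on U (fun x => \det (A x)).
Proof.
move=> As; apply: smooth_sum => s; apply: smoothM; first exact: smooth_cst.
by apply: smooth_prod => i; exact: As.
Qed.

Lemma smooth_invmx p (A : 'rV[R]_m -> 'M[R]_p) : smooth_mx A ->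
  (forall x, U x -> A x \in unitmx) -> smooth_mx (fun x => invmx (A x)).
Proof.
move=> As Au.
apply: (smooth_mx_eq (A := fun x => (\det (A x))^-1 *: \adj (A x))).
  by move=> x Ux; rewrite /invmx Au.
apply: smooth_mxZ.
  apply: smoothV; last exact: smooth_det.
  by move=> x Ux; have := Au x Ux; rewrite unitmxE unitfE.
move=> i j; apply: (smooth_eq (f := fun x => cofactor (A x) j i)).
  by move=> x _; rewrite mxE.
apply: smoothM; first exact: smooth_cst.
apply: smooth_det => k l.
by apply: (smooth_eq _ (As (lift j k) (lift i l))) => x _; rewrite !mxE.
Qed.

Lemma smooth_mx_comp n p q (V : set 'rV[R]_n) (F : 'rV[R]_m -> 'rV[R]_n)
    (A : 'rV[R]_n -> 'M[R]_(p, q)) : open V -> (forall x, U x -> V (F x)) ->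
  smooth_mx F -> (forall i j, smooth_on V (fun y => A y i j)) ->
  smooth_mx (fun x => A (F x)).
Proof.
move=> oV UV Fs As i j k; apply: (@Ck_comp _ _ _ _ U V F (fun y => A y i j)) => //.
  by move=> l; exact: Fs.
exact: As.
Qed.

End SmoothClosure.

Lemma smooth_mx_sub (R : realType) m p q (U U' : set 'rV[R]_m) (A : 'rV[R]_m -> 'M[R]_(p, q)) :
  U' `<=` U -> smooth_mx U A -> smooth_mx U' A.
Proof. by move=> sU As i j k; exact: Ck_sub sU (As i j k). Qed.

(** * The Levi-Civita connection in matrix form *)

Section LeviCivita.
Variables (R : realType) (m : nat).
Implicit Types (G T : 'rV[R]_m -> 'M[R]_m) (U : set 'rV[R]_m) (x u v : 'rV[R]_m).

(** Symmetric and invertible values: the generality in which the Levi-Civita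
   connection exists and is unique. *)
Definition local_metric U G := [/\ open U, smooth_mx U G,
  forall x, U x -> (G x)^T = G x & forall x, U x -> G x \in unitmx].

(** Connection matrix acting on row vectors from the right: the covariant
   derivative of a vector field [v] is ['D_'e_k v + v *m conn G k]. *)
Definition conn G k x : 'M[R]_m := \matrix_(i, l) christoffel G l k i x.

Definition conn_dir G x u : 'M[R]_m := \sum_k u ord0 k *: conn G k x.

Lemma christoffel_formE G x u v : christoffel_form G x u v = v *m conn_dir G x u.
Proof.
apply/rowP => l; rewrite !mxE exchange_big /=; apply: eq_bigr => j _.
rewrite summxE big_distrr /=; apply: eq_bigr => i _.
by rewrite !mxE; ring.
Qed.

Lemma nabla2E G T k x : differentiable T x ->
  nabla2 G T k x = 'D_'e_k T x - conn G k x *m T x - T x *m (conn G k x)^T.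
Proof.
move=> dT; apply/matrixP => i j; rewrite !mxE derive_mxE //.
congr (_ - _ - _); apply: eq_bigr => l _; rewrite !mxE //; exact: mulrC.
Qed.

Section OneMetric.
Variables (U : set 'rV[R]_m) (G : 'rV[R]_m -> 'M[R]_m).
Hypothesis mG : local_metric U G.

Let oU : open U. Proof. by case: mG. Qed.
Let sG : smooth_mx U G. Proof. by case: mG. Qed.
Let symG x : U x -> (G x)^T = G x. Proof. by case: mG => _ _ + _; apply. Qed.
Let uG x : U x -> G x \in unitmx. Proof. by case: mG => _ _ _; apply. Qed.

Lemma metric_entry_sym x i j : U x -> G x i j = G x j i.
Proof. by move=> Ux; rewrite -{1}(symG Ux) mxE. Qed.

Lemma derive_metric_sym x k i j : U x ->
  'D_'e_k (fun z => G z i j) x = 'D_'e_k (fun z => G z j i) x.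
Proof. by apply: (derive_open_eq _ oU) => y; exact: metric_entry_sym. Qed.

(** Twice the Christoffel symbols of the first kind, by the Koszul formula. *)
Definition koszul k x : 'M[R]_m := \matrix_(i, l)
  ('D_'e_k (fun z => G z i l) x + 'D_'e_i (fun z => G z k l) x
     - 'D_'e_l (fun z => G z k i) x).

Lemma connE k x : conn G k x = 2^-1 *: (koszul k x *m (invmx (G x))^T).
Proof.
apply/matrixP => i l; rewrite !mxE; congr (_ * _).
by apply: eq_bigr => p _; rewrite !mxE mulrC.
Qed.

Lemma conn_lower k x : U x -> conn G k x *m G x = 2^-1 *: koszul k x.
Proof.
move=> Ux; rewrite connE -scalemxAl -mulmxA -{2}(symG Ux) -trmx_mul.
by rewrite mulmxV ?uG // trmx1 mulmx1.
Qed.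

Lemma conn_sym k i l x : U x -> conn G k x i l = conn G i x k l.
Proof.
move=> Ux; rewrite !mxE; congr (_ * _); apply: eq_bigr => p _; congr (_ * _).
by rewrite (derive_metric_sym p k i Ux) [X in X - _]addrC.
Qed.

Lemma metric_compat k x : U x ->
  'D_'e_k G x = conn G k x *m G x + G x *m (conn G k x)^T.
Proof.
move=> Ux; have -> : G x *m (conn G k x)^T = (conn G k x *m G x)^T.
  by rewrite trmx_mul symG.
rewrite conn_lower //; apply/matrixP => i j; rewrite !mxE.
have dG : differentiable G x.
  exact: (smooth_mx_differentiable oU sG Ux).
rewrite (derive_mxE _ i j dG).
rewrite (derive_metric_sym k j i Ux) (derive_metric_sym i k j Ux).
rewrite (derive_metric_sym j k i Ux); lra.
Qed.

(** The entries of [B k *m G] are symmetric in the first two of their three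
   indices, so the Koszul combination of derivatives of [G] collapses to twice
   one of them.  This identifies a connection by its two characteristic
   properties, without computing any Christoffel symbol. *)
Lemma conn_unique (B : 'I_m -> 'M[R]_m) x : U x ->
  (forall k i l, B k i l = B i k l) ->
  (forall k, 'D_'e_k G x = B k *m G x + G x *m (B k)^T) ->
  forall k, conn G k x = B k.
Proof.
move=> Ux symB compatB k.
apply: (can_inj (mulmxK (uG Ux))); rewrite conn_lower //.
pose b k i j := (B k *m G x) i j.
have bsym a i j : b a i j = b i a j.
  by rewrite /b !mxE; apply: eq_bigr => l _; rewrite symB.
have bD a i j : 'D_'e_a (fun z => G z i j) x = b a i j + b a j i.
  rewrite -(derive_mxE _ i j (smooth_mx_differentiable oU sG Ux)).
  rewrite compatB mxE; congr (_ + _).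
  by rewrite /b -{1}(symG Ux) -trmx_mul mxE.
apply/matrixP => i j; rewrite -[RHS]/(b k i j) [LHS]mxE [X in _ * X]mxE !bD.
rewrite (bsym i k j) (bsym j k i) (bsym j i k) (bsym i j k); lra.
Qed.

Lemma smooth_inv_metric : smooth_mx U (fun x => invmx (G x)).
Proof. exact: (smooth_invmx oU sG (@uG)). Qed.

Lemma smooth_conn k : smooth_mx U (conn G k).
Proof.
apply: (smooth_mx_eq oU (A := fun x => 2^-1 *: (koszul k x *m (invmx (G x))^T))).
  by move=> x _; rewrite connE.
apply: (smooth_mxZ oU); first exact: smooth_cst.
apply: (smooth_mxM oU); last exact/(smooth_mxT oU)/smooth_inv_metric.
move=> i l; apply: (smooth_eq oU (f := fun x =>
   'D_'e_k (fun z => G z i l) x + 'D_'e_i (fun z => G z k l) x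
     + -1 * 'D_'e_l (fun z => G z k i) x)).
  by move=> x _; rewrite mxE mulN1r.
apply: (smoothD oU); first by apply: (smoothD oU); exact: smooth_derive.
by apply: (smoothM oU); [exact: smooth_cst|exact: smooth_derive].
Qed.

End OneMetric.
End LeviCivita.

(** * Transformation law of the connection *)

Section Jacobian.
Variables (R : realType) (m n : nat).
Implicit Types (f : 'rV[R]_m -> 'rV[R]_n) (x u : 'rV[R]_m).

Definition jac f x : 'M[R]_(m, n) := \matrix_(i, k) ('D_'e_i f x) ord0 k.

Lemma row_jac f x i : row i (jac f x) = 'D_'e_i f x.
Proof. by apply/rowP => k; rewrite !mxE. Qed.

Lemma derive_jac f x u : differentiable f x -> 'D_u f x = u *m jac f x.
Proof.
move=> df; rewrite derive_dir // mulmx_sum_row.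
by apply: eq_bigr => i _; rewrite row_jac.
Qed.

Lemma smooth_jac U f : open U -> smooth_mx U f -> smooth_mx U (jac f).
Proof.
move=> oU fs i k; apply: (smooth_eq oU (f := fun x => ('D_'e_i f x) ord0 k)).
  by move=> x _; rewrite mxE.
exact: (smooth_mx_derive oU i fs).
Qed.

Lemma row_derive p (A : 'rV[R]_m -> 'M[R]_(p, n)) x u j : differentiable A x ->
  row j ('D_u A x) = 'D_u (fun y => row j (A y)) x.
Proof.
move=> dA; apply/rowP => k; rewrite mxE.
have drow : differentiable (fun y => row j (A y)) x.
  apply: differentiable_mx => a b; rewrite (_ : (fun y => _) = fun y => A y j b).
    exact: differentiable_entry.
  by apply/funext => y; rewrite mxE.
rewrite derive_mxE //; apply: etrans (esym (derive_mxE u ord0 k drow)).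
by congr ('D_u _ x); apply/funext => y; rewrite mxE.
Qed.

End Jacobian.

Section ConnDir.
Variables (R : realType) (m : nat).
Implicit Types (G : 'rV[R]_m -> 'M[R]_m) (U : set 'rV[R]_m) (x u v : 'rV[R]_m).

Lemma conn_dir_mulmx G x p (u : 'rV[R]_p) (A : 'M[R]_(p, m)) :
  conn_dir G x (u *m A) = \sum_a u ord0 a *: conn_dir G x (row a A).
Proof.
rewrite /conn_dir; under [RHS]eq_bigr do rewrite scaler_sumr.
rewrite exchange_big /=; apply: eq_bigr => k _.
rewrite mxE scaler_suml; apply: eq_bigr => a _.
by rewrite scalerA mxE.
Qed.

(** The connection is torsion-free. *)
Lemma conn_dir_sym U G x u v : local_metric U G -> U x ->
  v *m conn_dir G x u = u *m conn_dir G x v.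
Proof.
move=> mG Ux; apply/rowP => l; rewrite !mxE.
under eq_bigr do rewrite summxE big_distrr.
under [RHS]eq_bigr do rewrite summxE big_distrr.
rewrite exchange_big /=; apply: eq_bigr => k _; apply: eq_bigr => j _.
by rewrite [in LHS]mxE [in RHS]mxE (conn_sym mG k j l Ux) mulrCA.
Qed.

Lemma metric_compat_dir U G x u : local_metric U G -> U x ->
  'D_u G x = conn_dir G x u *m G x + G x *m (conn_dir G x u)^T.
Proof.
move=> mG Ux; have [oU sG _ _] := mG.
rewrite (derive_dir u (smooth_mx_differentiable oU sG Ux)).
rewrite /conn_dir linear_sum /= mulmx_suml mulmx_sumr -big_split /=.
apply: eq_bigr => k _.
by rewrite (metric_compat mG) // linearZ /= -scalemxAl -scalemxAr scalerDr.
Qed.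

End ConnDir.

Section ConnChange.
Variables (R : realType) (m : nat) (U U' : set 'rV[R]_m).
Variables (G G' : 'rV[R]_m -> 'M[R]_m) (rho : 'rV[R]_m -> 'rV[R]_m).

(** [rho] is a local isometry, with [jac rho] acting on row vectors: the metric
   [G] is the pull-back of [G']. *)
Definition metric_change_on := [/\ local_metric U G, local_metric U' G',
  smooth_mx U rho, (forall x, U x -> U' (rho x)) &
  forall x, U x -> G x = jac rho x *m G' (rho x) *m (jac rho x)^T].

Hypothesis ch : metric_change_on.

(** The determinant of [G] is that of [G'] times the square of the Jacobian. *)
Lemma jac_unit x : U x -> jac rho x \in unitmx.
Proof.
case: ch => [[_ _ _ uG] _ _ _ GE] Ux.
have := uG x Ux; rewrite GE // !unitmxE !det_mulmx det_tr !unitrM.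
by case/andP.
Qed.

Lemma smooth_mx_change p q (A : 'rV[R]_m -> 'M[R]_(p, q)) :
  smooth_mx U' A -> smooth_mx U (fun x => A (rho x)).
Proof.
case: ch => [[oU _ _ _] [oU' _ _ _] srho UU' _] sA.
exact: (smooth_mx_comp oU oU' UU' srho sA).
Qed.

(** Up to the inverse Jacobian, the right-hand side is the pull-back of the
   connection of [G'].  It is torsion-free because mixed derivatives of [rho]
   commute, and compatible with [G] by the product rule; [conn_unique] applies. *)
Lemma conn_change k x : U x ->
  conn G k x *m jac rho x =
    'D_'e_k (jac rho) x + jac rho x *m conn_dir G' (rho x) ('D_'e_k rho x).
Proof.
move=> Ux; case: (ch) => mG mG' srho UU' GE.
have [oU sG symG uG] := mG; have [oU' sG' symG' uG'] := mG'.
have Ju := jac_unit Ux.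
have sJ := smooth_jac oU srho.
have dJ := smooth_mx_differentiable oU sJ Ux.
have drho := smooth_mx_differentiable oU srho Ux.
pose X i : 'M[R]_m := 'D_'e_i (jac rho) x + jac rho x *m conn_dir G' (rho x) ('D_'e_i rho x).
have -> : conn G k x = X k *m invmx (jac rho x); last by rewrite mulmxKV.
apply: (conn_unique mG (B := fun i => X i *m invmx (jac rho x)) Ux) => [a i l|a].
  suff rowX : row i (X a) = row a (X i).
    have entry b c : (X b *m invmx (jac rho x)) c l = (row c (X b) *m invmx (jac rho x)) ord0 l.
      by rewrite -row_mul [RHS]mxE.
    apply: etrans (entry a i) _; apply: etrans (esym (entry i a)).
    by rewrite rowX.
  have rowX b c : row c (X b) = 'D_'e_b ('D_'e_c rho) x
      + 'D_'e_c rho x *m conn_dir G' (rho x) ('D_'e_b rho x).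
    rewrite /X raddfD /= row_mul row_jac; congr (_ + _).
    apply: etrans (row_derive 'e_b c dJ) _.
    by congr ('D_'e_b _ x); apply/funext => y; rewrite row_jac.
  apply: etrans (rowX a i) _; apply: etrans (esym (rowX i a)).
  have mixed := smooth_mx_schwarz oU i a srho Ux.
  have sym := conn_dir_sym ('D_'e_a rho x) ('D_'e_i rho x) mG' (UU' x Ux).
  exact: (congr2 +%R mixed sym).
have dG' := smooth_mx_differentiable oU (smooth_mx_change sG') Ux.
have dG'rho : differentiable G' (rho x) := smooth_mx_differentiable oU' sG' (UU' x Ux).
have derG' : 'D_'e_a (fun y => G' (rho y)) x =
    conn_dir G' (rho x) ('D_'e_a rho x) *m G' (rho x)
    + G' (rho x) *m (conn_dir G' (rho x) ('D_'e_a rho x))^T.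
  apply: etrans (derive_comp 'e_a drho dG'rho) _.
  exact: metric_compat_dir mG' (UU' x Ux).
have derG : 'D_'e_a G x = X a *m G' (rho x) *m (jac rho x)^T
    + jac rho x *m G' (rho x) *m (X a)^T.
  apply: etrans (derive_open_eq 'e_a oU GE Ux) _.
  apply: etrans (derive_mulmx 'e_a (differentiable_mulmx dJ dG') (differentiable_trmx dJ)) _.
  rewrite (derive_mulmx 'e_a dJ dG') (derive_trmx 'e_a dJ) derG'.
  rewrite /X [(_ + _)^T]linearD /= trmx_mul !(mulmxDl, mulmxDr) !mulmxA.
  by rewrite -!addrA; congr (_ + (_ + _)); rewrite addrC.
rewrite derG (GE x Ux) trmx_mul; congr (_ + _).
  by rewrite !mulmxA mulmxKV.
rewrite -!mulmxA; congr (_ *m (_ *m _)).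
by rewrite mulmxA -trmx_mul mulVmx // trmx1 mul1mx.
Qed.

Lemma conn_dir_change u x : U x ->
  conn_dir G x u *m jac rho x =
    'D_u (jac rho) x + jac rho x *m conn_dir G' (rho x) (u *m jac rho x).
Proof.
move=> Ux; case: (ch) => [[oU _ _ _] _ srho _ _].
have dJ := smooth_mx_differentiable oU (smooth_jac oU srho) Ux.
rewrite {1}/conn_dir mulmx_suml (derive_dir u dJ) conn_dir_mulmx.
rewrite mulmx_sumr -big_split /=; apply: eq_bigr => k _.
by rewrite -scalemxAl conn_change // scalerDr scalemxAr row_jac.
Qed.

End ConnChange.

(** * The tension field and the stress-energy tensor in matrix form *)

Section MapMatrices.
Variables (R : realType) (m n : nat).
Variables (G : 'rV[R]_m -> 'M[R]_m) (H : 'rV[R]_n -> 'M[R]_n).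
Variable f : 'rV[R]_m -> 'rV[R]_n.
Implicit Types (x : 'rV[R]_m) (V : 'rV[R]_m -> 'rV[R]_n).

(** Row [i] is the covariant derivative of [V] in the direction [i]. *)
Definition nabla_mx V x : 'M[R]_(m, n) := \matrix_(i, k) nabla_pull H f i V x ord0 k.

(** Row [j] is the value of the second fundamental form on the directions [i], [j]
   ([row_sff_mx]).  Grouping the values by [i] makes it the covariant derivative
   of the matrix [jac f], with one connection acting on each side. *)
Definition sff_mx i x : 'M[R]_(m, n) :=
  'D_'e_i (jac f) x + jac f x *m conn_dir H (f x) ('D_'e_i f x) - conn G i x *m jac f x.

(** The bilinear form sending [X], [Y] to the inner product of df(X) and the
   covariant derivative of the tension in the direction [Y]. *)
Definition stress_pairing x : 'M[R]_m :=
  jac f x *m H (f x) *m (nabla_mx (tension G H f) x)^T.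

Lemma nabla_pullE i V x :
  nabla_pull H f i V x = 'D_'e_i V x + V x *m conn_dir H (f x) ('D_'e_i f x).
Proof. by rewrite /nabla_pull christoffel_formE. Qed.

Lemma row_nabla_mx i V x : row i (nabla_mx V x) = nabla_pull H f i V x.
Proof. by apply/rowP => k; rewrite !mxE. Qed.

Lemma row_sff_mx i j x : differentiable (jac f) x ->
  row j (sff_mx i x) = second_fundamental G H f i j x.
Proof.
move=> dF; rewrite /sff_mx /second_fundamental nabla_pullE.
rewrite [LHS]raddfB /= [X in X - _]raddfD /= !row_mul row_jac.
have -> : row j ('D_'e_i (jac f) x) = 'D_'e_i ('D_'e_j f) x.
  apply: etrans (row_derive 'e_i j dF) _.
  by congr ('D_'e_i _ x); apply/funext => y; rewrite row_jac.
congr (_ - _); rewrite mulmx_sum_row; apply: eq_bigr => k _.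
by rewrite row_jac !mxE.
Qed.

Lemma tensionE x : differentiable (jac f) x ->
  tension G H f x = \sum_i row i (invmx (G x)) *m sff_mx i x.
Proof.
move=> dF; apply: eq_bigr => i _; rewrite mulmx_sum_row; apply: eq_bigr => j _.
by rewrite row_sff_mx // mxE.
Qed.

Lemma sum_mul_trace p q (A B : 'M[R]_(p, q)) :
  \sum_i \sum_j A i j * B i j = \tr (A^T *m B).
Proof.
rewrite /mxtrace exchange_big /=; apply: eq_bigr => j _.
by rewrite mxE; apply: eq_bigr => i _; rewrite mxE.
Qed.

Lemma row_form_entry p q r s (A : 'M[R]_(p, q)) (B : 'M[R]_(q, r)) (C : 'M[R]_(s, r)) i j :
  (row i A *m B *m (row j C)^T) ord0 ord0 = (A *m B *m C^T) i j.
Proof. by rewrite -row_mul !mxE; apply: eq_bigr => k _; rewrite !mxE. Qed.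

Lemma stressE x : stress_bienergy_mx G H f x =
  (inner H (f x) (tension G H f x) (tension G H f x) / 2
     + \tr ((invmx (G x))^T *m stress_pairing x)) *: G x
  - stress_pairing x - (stress_pairing x)^T.
Proof.
have BE i j : inner H (f x) ('D_'e_i f x) (nabla_pull H f j (tension G H f) x)
    = stress_pairing x i j.
  by rewrite /inner /stress_pairing -row_jac -row_nabla_mx row_form_entry.
have entry (c : R) (A B : 'M[R]_m) i j : (c *: A - B - B^T) i j = c * A i j - B i j - B j i.
  by rewrite !mxE.
apply/matrixP => i j; apply: etrans (esym (entry _ _ _ i j)); rewrite mxE.
have trE : \sum_k \sum_l inv_metric G x k l *
     inner H (f x) ('D_'e_k f x) (nabla_pull H f l (tension G H f) x)
   = \tr ((invmx (G x))^T *m stress_pairing x).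
  by rewrite -sum_mul_trace; apply: eq_bigr => k _; apply: eq_bigr => l _; rewrite BE.
apply: (congr2 (fun a b => a - b) _ (BE j i)); apply: (congr2 (fun a b => a - b) _ (BE i j)).
by rewrite trE.
Qed.

Lemma stress_sym x : (G x)^T = G x ->
  (stress_bienergy_mx G H f x)^T = stress_bienergy_mx G H f x.
Proof.
by move=> symG; rewrite stressE !linearB /= linearZ /= symG trmxK addrAC.
Qed.

End MapMatrices.

Section SmoothStress.
Variables (R : realType) (m n : nat).
Variables (U : set 'rV[R]_m) (W : set 'rV[R]_n).
Variables (G : 'rV[R]_m -> 'M[R]_m) (H : 'rV[R]_n -> 'M[R]_n).
Variable f : 'rV[R]_m -> 'rV[R]_n.

Definition smooth_setting := [/\ local_metric U G, local_metric W H,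
  smooth_mx U f & forall x, U x -> W (f x)].

Hypothesis st : smooth_setting.

Let oU : open U. Proof. by case: st => [[]]. Qed.
Let sf : smooth_mx U f. Proof. by case: st. Qed.

Let comp p q (A : 'rV[R]_n -> 'M[R]_(p, q)) : smooth_mx W A -> smooth_mx U (fun x => A (f x)).
Proof. case: st => _ [oW _ _ _] _ UW sA; exact: (smooth_mx_comp oU oW UW sf sA). Qed.

Lemma smooth_conn_along (V : 'rV[R]_m -> 'rV[R]_n) : smooth_mx U V ->
  smooth_mx U (fun x => conn_dir H (f x) (V x)).
Proof.
move=> sV; apply: (smooth_mx_sum oU) => k; apply: (smooth_mxZ oU); first exact: sV.
apply: (comp (A := conn H k)); case: st => _ mH _ _; exact: (smooth_conn mH k).
Qed.

Lemma smooth_nabla_mx V : smooth_mx U V -> smooth_mx U (nabla_mx H f V).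
Proof.
move=> sV i k.
have sD (Y : 'rV[R]_m -> 'rV[R]_n) : smooth_mx U Y -> smooth_mx U ('D_'e_i Y).
  exact: smooth_mx_derive.
have snabla := smooth_mxD oU (sD V sV) (smooth_mxM oU sV (smooth_conn_along (sD f sf))).
apply: (smooth_eq oU _ (snabla ord0 k)) => x _.
by rewrite [RHS]mxE nabla_pullE.
Qed.

Lemma smooth_sff i : smooth_mx U (sff_mx G H f i).
Proof.
have sF := smooth_jac oU sf.
apply: (smooth_mxD oU).
  apply: (smooth_mxD oU); first exact: smooth_mx_derive.
  by apply: (smooth_mxM oU) => //; apply: smooth_conn_along; exact: smooth_mx_derive.
apply: (smooth_mxN oU); apply: (smooth_mxM oU) => //.
by case: st => mG _ _ _; exact: (smooth_conn mG i).
Qed.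

Lemma smooth_tension : smooth_mx U (tension G H f).
Proof.
have sF := smooth_jac oU sf.
apply: (smooth_mx_eq oU (A := fun x => \sum_i row i (invmx (G x)) *m sff_mx G H f i x)).
  by move=> x Ux; rewrite tensionE //; exact: (smooth_mx_differentiable oU sF Ux).
apply: (smooth_mx_sum oU) => i; apply: (smooth_mxM oU); last exact: smooth_sff.
move=> a b; apply: (smooth_eq oU (f := fun x => invmx (G x) i b)).
  by move=> x _; rewrite mxE.
by case: st => mG _ _ _; exact: (smooth_inv_metric mG).
Qed.

Lemma smooth_pairing : smooth_mx U (stress_pairing G H f).
Proof.
apply: (smooth_mxM oU); last exact/(smooth_mxT oU)/smooth_nabla_mx/smooth_tension.
apply: (smooth_mxM oU); first exact: smooth_jac.
by apply: comp; case: st => _ [].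
Qed.

Lemma smooth_stress : smooth_mx U (stress_bienergy_mx G H f).
Proof.
have sB := smooth_pairing; have st' := smooth_tension.
apply: (smooth_mx_eq oU (A := fun x =>
  (inner H (f x) (tension G H f x) (tension G H f x) * 2^-1
     + \tr ((invmx (G x))^T *m stress_pairing G H f x)) *: G x
  + - stress_pairing G H f x + - (stress_pairing G H f x)^T)).
  by move=> x _; rewrite stressE.
apply: (smooth_mxD oU); last exact/(smooth_mxN oU)/(smooth_mxT oU).
apply: (smooth_mxD oU); last exact/(smooth_mxN oU).
apply: (smooth_mxZ oU); last by case: st => [[]].
apply: (smoothD oU).
  apply: (smoothM oU); last exact: smooth_cst.
  apply: (smooth_mxM oU); last exact: (smooth_mxT oU).
  by apply: (smooth_mxM oU) => //; apply: comp; case: st => _ [].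
apply: (smooth_sum oU) => i; apply: (smooth_mxM oU) => //; apply: (smooth_mxT oU).
by case: st => mG _ _ _; exact: (smooth_inv_metric mG).
Qed.

End SmoothStress.

(** * Change of coordinates in the target *)

Section TargetChange.
Variables (R : realType) (m n : nat).
Variables (U : set 'rV[R]_m) (W W' : set 'rV[R]_n).
Variables (G : 'rV[R]_m -> 'M[R]_m) (H H' : 'rV[R]_n -> 'M[R]_n).
Variables (f f' : 'rV[R]_m -> 'rV[R]_n) (psi : 'rV[R]_n -> 'rV[R]_n).
Hypothesis ch : metric_change_on W W' H H' psi.
Hypothesis st : smooth_setting U W G H f.
Hypothesis f'E : forall x, U x -> f' x = psi (f x).

Let K x := jac psi (f x).

Let oU : open U. Proof. by case: st => [[]]. Qed.
Let df x : U x -> differentiable f x.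
Proof. by move=> Ux; case: st => _ _ sf _; exact: (smooth_mx_differentiable oU sf Ux). Qed.
Let Wf x : U x -> W (f x). Proof. by case: st => _ _ _; apply. Qed.
Let dpsi x : U x -> differentiable psi (f x).
Proof.
by move=> Ux; case: ch => [[oW _ _ _] _ spsi _ _]; exact: (smooth_mx_differentiable oW spsi (Wf Ux)).
Qed.
Let djpsi x : U x -> differentiable (jac psi) (f x).
Proof.
move=> Ux; case: ch => [[oW _ _ _] _ spsi _ _].
exact: (smooth_mx_differentiable oW (smooth_jac oW spsi) (Wf Ux)).
Qed.
Let dK x : U x -> differentiable K x.
Proof. by move=> Ux; exact: (differentiable_comp (df Ux) (djpsi Ux)). Qed.
Let djf x : U x -> differentiable (jac f) x.
Proof. by move=> Ux; case: st => _ _ sf _; exact: (smooth_mx_differentiable oU (smooth_jac oU sf) Ux). Qed.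

Lemma derive_target_change i x : U x -> 'D_'e_i f' x = 'D_'e_i f x *m K x.
Proof.
move=> Ux; apply: etrans (derive_open_eq 'e_i oU f'E Ux) _.
apply: etrans (derive_comp 'e_i (df Ux) (dpsi Ux)) _.
exact: (derive_jac _ (dpsi Ux)).
Qed.

Lemma jac_target_change x : U x -> jac f' x = jac f x *m K x.
Proof.
move=> Ux; apply/row_matrixP => i.
by rewrite row_mul !row_jac derive_target_change.
Qed.

(** The derivative of the Jacobian factor [K] is exactly what the transformation
   law of the connection absorbs. *)
Lemma cov_target_change p (A A' : 'rV[R]_m -> 'M[R]_(p, n)) i x : U x ->
  differentiable A x -> (forall y, U y -> A' y = A y *m K y) ->
  'D_'e_i A' x + A' x *m conn_dir H' (f' x) ('D_'e_i f' x)
    = ('D_'e_i A x + A x *m conn_dir H (f x) ('D_'e_i f x)) *m K x.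
Proof.
move=> Ux dA A'E; rewrite (derive_open_eq 'e_i oU A'E Ux) (derive_mulmx 'e_i dA (dK Ux)).
rewrite (derive_comp 'e_i (df Ux) (djpsi Ux)) (A'E x Ux) (f'E Ux) (derive_target_change i Ux).
rewrite mulmxDl -[A x *m conn_dir _ _ _ *m _]mulmxA (conn_dir_change ch _ (Wf Ux)).
by rewrite mulmxDr addrA mulmxA.
Qed.

Lemma nabla_target_change (V V' : 'rV[R]_m -> 'rV[R]_n) x : U x ->
  differentiable V x -> (forall y, U y -> V' y = V y *m K y) ->
  nabla_mx H' f' V' x = nabla_mx H f V x *m K x.
Proof.
move=> Ux dV V'E; apply/row_matrixP => i.
rewrite row_mul !row_nabla_mx !nabla_pullE; exact: cov_target_change.
Qed.

Lemma sff_target_change i x : U x ->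
  sff_mx G H' f' i x = sff_mx G H f i x *m K x.
Proof.
move=> Ux; have covE := cov_target_change i Ux (djf Ux) jac_target_change.
have connE : conn G i x *m jac f' x = conn G i x *m jac f x *m K x.
  by rewrite (jac_target_change Ux) mulmxA.
apply: etrans (congr2 (fun a b => a - b) covE connE) _.
by rewrite -mulmxBl.
Qed.

Lemma smooth_setting_target : smooth_setting U W' G H' f'.
Proof.
case: st => mG mH sf UW; case: (ch) => _ mH' spsi WW' _; split=> //; last first.
  by move=> x Ux; rewrite f'E //; exact/WW'/UW.
apply: (smooth_mx_eq oU (A := fun x => psi (f x))) => [x Ux|]; first by rewrite f'E.
case: mH => oW _ _ _; exact: (smooth_mx_comp oU oW UW sf spsi).
Qed.

Lemma tension_target_change x : U x ->
  tension G H' f' x = tension G H f x *m K x.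
Proof.
move=> Ux; case: smooth_setting_target => _ _ sf' _.
have djf' := smooth_mx_differentiable oU (smooth_jac oU sf') Ux.
rewrite (tensionE _ _ djf') (tensionE _ _ (djf Ux)) mulmx_suml.
by apply: eq_bigr => i _; rewrite sff_target_change // mulmxA.
Qed.

Lemma inner_target_change x (u v : 'rV[R]_n) : U x ->
  inner H' (f' x) (u *m K x) (v *m K x) = inner H (f x) u v.
Proof.
move=> Ux; case: ch => _ _ _ _ HE.
by rewrite /inner (HE _ (Wf Ux)) (f'E Ux) trmx_mul !mulmxA.
Qed.

(** The components of the stress-energy tensor at a point are computed in a chart
   of the target that depends on that point.  By this invariance, one chart can
   be fixed near a given point, so that the components can be differentiated. *)
Lemma stress_target_change x : U x ->
  stress_bienergy_mx G H' f' x = stress_bienergy_mx G H f x.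
Proof.
move=> Ux; have dt := smooth_mx_differentiable oU (smooth_tension st) Ux.
have pairE : stress_pairing G H' f' x = stress_pairing G H f x.
  rewrite /stress_pairing (nabla_target_change Ux dt tension_target_change).
  rewrite (jac_target_change Ux); case: ch => _ _ _ _ HE.
  by rewrite (HE _ (Wf Ux)) (f'E Ux) trmx_mul !mulmxA.
by rewrite !stressE pairE (tension_target_change Ux) inner_target_change.
Qed.

End TargetChange.

(** * Change of coordinates in the source *)

(** The matrix identity behind [sff_source_change]: [C] and [D] are the connection
   matrices of the two source metrics, [J] is the Jacobian, [E] the connection
   matrix of the target, and [dJ], [dF], [dF0] are derivatives of [J], [F], [F0]. *)
Lemma sff_change_mx (R : comNzRingType) m n (C J dJ D : 'M[R]_m)
    (F dF F0 dF0 Z : 'M[R]_(m, n)) (E : 'M[R]_n) :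
  C *m J = dJ + J *m D -> F0 = J *m F -> dF0 = dJ *m F + J *m dF -> dF + F *m E = Z ->
  dF0 + F0 *m E - C *m F0 = J *m (Z - D *m F).
Proof.
move=> CJ -> -> <-.
rewrite mulmxA CJ mulmxDl opprD !(mulmxDr, mulmxN) !mulmxA.
rewrite addrA; congr (_ - _); rewrite addrAC; congr (_ + _).
by rewrite addrAC subrr add0r.
Qed.

Lemma contraction_change_mx (R : comNzRingType) m n (I I' J : 'M[R]_m) (S S' : 'I_m -> 'M[R]_(m, n)) :
  (forall i, S i = J *m \sum_a J i a *: S' a) -> I' = J^T *m I *m J ->
  \sum_i row i I *m S i = \sum_a row a I' *m S' a.
Proof.
move=> SE ->; under eq_bigr do rewrite SE mulmxA mulmx_sumr.
rewrite exchange_big /=; apply: eq_bigr => a _.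
rewrite -[in RHS]mulmxA [in RHS]row_mul [row a J^T *m _]mulmx_sum_row mulmx_suml.
apply: eq_bigr => i _; rewrite -scalemxAr -scalemxAl row_mul; congr (_ *: _).
by rewrite !mxE.
Qed.

Lemma stress_change_mx (R : comNzRingType) m (c c' : R) (G G' B B' J : 'M[R]_m) :
  c = c' -> G = J *m G' *m J^T -> B = J *m B' *m J^T ->
  c *: G - B - B^T = J *m (c' *: G' - B' - B'^T) *m J^T.
Proof.
move=> -> -> ->; rewrite !(mulmxBr, mulmxBl) -scalemxAr -scalemxAl; congr (_ - _).
by rewrite !trmx_mul trmxK mulmxA.
Qed.

Section SourceChange.
Variables (R : realType) (m n : nat).
Variables (U U' : set 'rV[R]_m) (W : set 'rV[R]_n).
Variables (G G' : 'rV[R]_m -> 'M[R]_m) (H : 'rV[R]_n -> 'M[R]_n).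
Variables (f f' : 'rV[R]_m -> 'rV[R]_n) (rho : 'rV[R]_m -> 'rV[R]_m).
Hypothesis ch : metric_change_on U U' G G' rho.
Hypothesis st : smooth_setting U' W G' H f'.
Hypothesis fE : forall x, U x -> f x = f' (rho x).

Let J x := jac rho x.

Let oU : open U. Proof. by case: ch => [[]]. Qed.
Let oU' : open U'. Proof. by case: ch => _ []. Qed.
Let UU' x : U x -> U' (rho x). Proof. by case: ch => _ _ _ + _; apply. Qed.
Let drho x : U x -> differentiable rho x.
Proof. by move=> Ux; case: ch => _ _ srho _ _; exact: (smooth_mx_differentiable oU srho Ux). Qed.
Let dJ x : U x -> differentiable J x.
Proof.
by move=> Ux; case: ch => _ _ srho _ _; exact: (smooth_mx_differentiable oU (smooth_jac oU srho) Ux).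
Qed.
Let df' y : U' y -> differentiable f' y.
Proof. by move=> U'y; case: st => _ _ sf _; exact: (smooth_mx_differentiable oU' sf U'y). Qed.
Let djf' y : U' y -> differentiable (jac f') y.
Proof.
by move=> U'y; case: st => _ _ sf _; exact: (smooth_mx_differentiable oU' (smooth_jac oU' sf) U'y).
Qed.

Lemma derive_source_change i x : U x -> 'D_'e_i f x = 'D_'e_i rho x *m jac f' (rho x).
Proof.
move=> Ux; apply: etrans (derive_open_eq 'e_i oU fE Ux) _.
apply: etrans (derive_comp 'e_i (drho Ux) (df' (UU' Ux))) _.
exact: (derive_jac _ (df' (UU' Ux))).
Qed.

Lemma jac_source_change x : U x -> jac f x = J x *m jac f' (rho x).
Proof.
move=> Ux; apply/row_matrixP => i.
by rewrite row_mul !row_jac derive_source_change.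
Qed.

(** The pulled-back connection is linear in the direction of derivation, so only
   the chain rule is involved here; the connection of the source enters with the
   derivative of the Jacobian in [sff_source_change]. *)
Lemma cov_source_change p (A : 'rV[R]_m -> 'M[R]_(p, n)) i x : U x ->
  differentiable A (rho x) ->
  'D_'e_i (fun y => A (rho y)) x + A (rho x) *m conn_dir H (f x) ('D_'e_i f x)
    = \sum_a J x i a *: ('D_'e_a A (rho x)
        + A (rho x) *m conn_dir H (f' (rho x)) ('D_'e_a f' (rho x))).
Proof.
move=> Ux dA; rewrite (derive_comp 'e_i (drho Ux) dA) (derive_dir _ dA).
rewrite (derive_source_change i Ux) conn_dir_mulmx (fE Ux) mulmx_sumr -big_split /=.
by apply: eq_bigr => a _; rewrite row_jac -scalemxAr scalerDr mxE.
Qed.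

Lemma nabla_source_change (V V' : 'rV[R]_m -> 'rV[R]_n) x : U x ->
  differentiable V' (rho x) -> (forall y, U y -> V y = V' (rho y)) ->
  nabla_mx H f V x = J x *m nabla_mx H f' V' (rho x).
Proof.
move=> Ux dV' VE; apply/row_matrixP => i.
rewrite row_mul row_nabla_mx nabla_pullE (derive_open_eq 'e_i oU VE Ux) (VE x Ux).
rewrite (cov_source_change i Ux dV') mulmx_sum_row.
by apply: eq_bigr => a _; rewrite row_nabla_mx nabla_pullE [in RHS]mxE.
Qed.

Lemma sff_source_change i x : U x ->
  sff_mx G H f i x = J x *m \sum_a J x i a *: sff_mx G' H f' a (rho x).
Proof.
move=> Ux; have djf'x := djf' (UU' Ux).
have dFE : 'D_'e_i (jac f) x =
    'D_'e_i J x *m jac f' (rho x) + J x *m 'D_'e_i (fun y => jac f' (rho y)) x.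
  apply: etrans (derive_open_eq 'e_i oU jac_source_change Ux) _.
  exact: (derive_mulmx 'e_i (dJ Ux) (differentiable_comp (drho Ux) djf'x)).
apply: etrans (sff_change_mx (conn_change ch i Ux) (jac_source_change Ux) dFE
  (cov_source_change i Ux djf'x)) _.
congr (_ *m _); rewrite {1}/conn_dir mulmx_suml -sumrB; apply: eq_bigr => a _.
by rewrite -scalemxAl scalerBr mxE.
Qed.

Lemma inv_metric_change x : U x -> invmx (G' (rho x)) = (J x)^T *m invmx (G x) *m J x.
Proof.
move=> Ux; case: (ch) => [[_ _ _ uG] [_ _ _ uG'] _ _ GE].
have Ju := jac_unit ch Ux.
apply: (can_inj (mulmxK (uG' _ (UU' Ux)))); rewrite (mulVmx (uG' _ (UU' Ux))).
have JTu : (J x)^T \in unitmx by rewrite unitmx_tr.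
apply: (can_inj (mulmxK JTu)); rewrite mul1mx -!mulmxA.
have GEx : J x *m (G' (rho x) *m (J x)^T) = G x by rewrite mulmxA -GE.
by rewrite GEx (mulVmx (uG _ Ux)) mulmx1.
Qed.

Lemma smooth_setting_source : smooth_setting U W G H f.
Proof.
case: (ch) => mG _ srho _ _; case: (st) => _ mH sf' UW; split=> //; last first.
  by move=> x Ux; rewrite fE //; exact/UW/UU'.
apply: (smooth_mx_eq oU (A := fun x => f' (rho x))) => [x Ux|]; first by rewrite fE.
exact: (smooth_mx_change ch sf').
Qed.

Lemma tension_source_change x : U x -> tension G H f x = tension G' H f' (rho x).
Proof.
move=> Ux; case: smooth_setting_source => _ _ sf _.
have djf := smooth_mx_differentiable oU (smooth_jac oU sf) Ux.
rewrite (tensionE _ _ djf) (tensionE _ _ (djf' (UU' Ux))).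
exact: contraction_change_mx (fun i => sff_source_change i Ux) (inv_metric_change Ux).
Qed.

Lemma inner_tension_source_change x : U x ->
  inner H (f x) (tension G H f x) (tension G H f x) =
  inner H (f' (rho x)) (tension G' H f' (rho x)) (tension G' H f' (rho x)).
Proof. by move=> Ux; rewrite (tension_source_change Ux) (fE Ux). Qed.

(** The second fundamental form, hence all the ingredients of the stress-energy
   tensor, transform like tensors. *)
Lemma stress_source_change x : U x ->
  stress_bienergy_mx G H f x =
    J x *m stress_bienergy_mx G' H f' (rho x) *m (J x)^T.
Proof.
move=> Ux.
have dt := smooth_mx_differentiable oU' (smooth_tension st) (UU' Ux).
case: (ch) => _ _ _ _ GE.
have pairE : stress_pairing G H f x = J x *m stress_pairing G' H f' (rho x) *m (J x)^T.
  rewrite /stress_pairing (nabla_source_change Ux dt tension_source_change).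
  by rewrite (jac_source_change Ux) (fE Ux) trmx_mul !mulmxA.
have trE : \tr ((invmx (G x))^T *m stress_pairing G H f x) =
    \tr ((invmx (G' (rho x)))^T *m stress_pairing G' H f' (rho x)).
  rewrite pairE (inv_metric_change Ux) !mulmxA mxtrace_mulC !trmx_mul trmxK !mulmxA.
  by [].
have coefE := congr2 (fun a b : R => a / 2 + b) (inner_tension_source_change Ux) trE.
apply: etrans (stressE G H f x) _.
apply: etrans (stress_change_mx coefE (GE x Ux) pairE) _.
exact: (congr1 (fun T => J x *m T *m (J x)^T) (esym (stressE G' H f' (rho x)))).
Qed.

End SourceChange.

(** * Parallel symmetric tensors *)

(** Needed because the stress-energy tensor is given by a smooth formula near each
   point, but not by the same formula near all of them. *)
Lemma Ck_local (R : realType) m k (U : set 'rV[R]_m) (f : 'rV[R]_m -> R) :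
  (forall x, U x -> exists2 V, V x & Ck k V f) -> Ck k U f.
Proof.
elim: k f => [|k IH] f loc.
  by split=> // x /loc[V Vx fk]; exact: (Ck_continuous fk Vx).
split=> [x /loc[V Vx fk]|i]; first exact: (Ck_continuous fk Vx).
split=> [x /loc[V Vx [_ /(_ i)[fd _]]]|]; first exact: fd.
by apply: IH => x /loc[V Vx fk]; exists V => //; exact: Ck_derive.
Qed.

(** The scalar cancellation of [ricci_mx], entry by entry: each letter stands for
   an entry of one of the products occurring there. *)
Lemma ricci_cancel (R : comNzRingType) (a b c d e f a' b' e' f' : R) :
  a + (b + c) + (d + e + f) = a' + (b' + d) + (c + e' + f') ->
  a - a' + (b - b') + (f - f' + (e - e')) = 0.
Proof. by move=> /eqP; rewrite -subr_eq0 => /eqP <-; ring. Qed.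

Lemma ricci_mx (R : comNzRingType) m (D D' C C' S : 'M[R]_m) :
  D *m S + C *m (C' *m S + S *m C'^T) + ((C' *m S + S *m C'^T) *m C^T + S *m D^T) =
  D' *m S + C' *m (C *m S + S *m C^T) + ((C *m S + S *m C^T) *m C'^T + S *m D'^T) ->
  (D - D' + (C *m C' - C' *m C)) *m S + S *m (D - D' + (C *m C' - C' *m C))^T = 0.
Proof.
have trE : (D - D' + (C *m C' - C' *m C))^T = D^T - D'^T + (C'^T *m C^T - C^T *m C'^T).
  by rewrite [LHS]raddfD /= !raddfB /= !trmx_mul.
rewrite trE !(mulmxDr, mulmxDl) !(mulmxN, mulNmx) !mulmxA => E.
apply/matrixP => i j; have /matrixP/(_ i j) := E; rewrite !mxE.
exact: ricci_cancel.
Qed.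

Lemma derive_raised_mx (R : comNzRingType) m (A C G T : 'M[R]_m) : A *m G = T ->
  C *m T + T *m C^T - A *m (C *m G + G *m C^T) = (C *m A - A *m C) *m G.
Proof. by move=> <-; rewrite mulmxBl mulmxDr !mulmxA opprD addrACA subrr addr0. Qed.

Lemma mxtrace_commutator_sqr (R : comNzRingType) m (A C : 'M[R]_m) :
  \tr ((C *m A - A *m C) *m A + A *m (C *m A - A *m C)) = 0.
Proof.
rewrite mulmxBl mulmxBr mxtraceD !raddfB /= !mulmxA addrA addrNK.
by rewrite -[C *m A *m A]mulmxA mxtrace_mulC subrr.
Qed.

Section ParallelTensor.
Variables (R : realType) (m : nat) (U : set 'rV[R]_m) (G T : 'rV[R]_m -> 'M[R]_m).
Hypothesis mG : local_metric U G.
Hypothesis sT : smooth_mx U T.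
Hypothesis parT : forall k x, U x -> nabla2 G T k x = 0.

Let oU : open U. Proof. by case: mG. Qed.
Let dT x : U x -> differentiable T x.
Proof. by move=> Ux; exact: (smooth_mx_differentiable oU sT Ux). Qed.
Let dC k x : U x -> differentiable (conn G k) x.
Proof. by move=> Ux; exact: (smooth_mx_differentiable oU (smooth_conn mG k) Ux). Qed.

Lemma parallel_derive k x : U x ->
  'D_'e_k T x = conn G k x *m T x + T x *m (conn G k x)^T.
Proof.
move=> Ux; have := nabla2E G k (dT Ux); rewrite (parT k Ux) => /esym/eqP.
by rewrite -addrA -opprD subr_eq0 => /eqP.
Qed.

(** The matrix, acting on row vectors, of the curvature operator in the plane of
   the directions [i] and [j]. *)
Definition riemann_mx i j x : 'M[R]_m := \matrix_(k, l) riemann G x i j k l.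

Lemma riemann_mxE i j x : U x -> riemann_mx i j x =
  'D_'e_i (conn G j) x - 'D_'e_j (conn G i) x
  + (conn G j x *m conn G i x - conn G i x *m conn G j x).
Proof.
move=> Ux.
have entryE a b k l : ('D_'e_a (conn G b) x) k l = 'D_'e_a (christoffel G l b k) x.
  apply: etrans (derive_mxE 'e_a k l (dC b Ux)) _.
  by congr ('D_'e_a _ x); apply/funext => y; rewrite mxE.
apply/matrixP => k l; rewrite mxE [RHS]mxE; apply: (congr2 +%R).
  rewrite [RHS]mxE; apply: (congr2 +%R (esym (entryE i j k l))).
  by rewrite mxE; exact: (congr1 -%R (esym (entryE j i k l))).
rewrite [RHS]mxE [X in X + _]mxE [X in _ + X]mxE [X in _ - X]mxE -sumrB.
apply: eq_bigr => p _; apply: (congr2 (fun a b => a - b)).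
  by rewrite mulrC !mxE.
by rewrite mulrC !mxE.
Qed.

Lemma second_derive i j x : U x ->
  'D_'e_i ('D_'e_j T) x =
    'D_'e_i (conn G j) x *m T x
    + conn G j x *m (conn G i x *m T x + T x *m (conn G i x)^T)
    + ((conn G i x *m T x + T x *m (conn G i x)^T) *m (conn G j x)^T
       + T x *m ('D_'e_i (conn G j) x)^T).
Proof.
move=> Ux; apply: etrans (derive_open_eq 'e_i oU (parallel_derive j) Ux) _.
have dCT := differentiable_trmx (dC j Ux).
have d1 := differentiable_mulmx (dC j Ux) (dT Ux).
have d2 := differentiable_mulmx (dT Ux) dCT.
apply: etrans (deriveD (diff_derivable d1) (diff_derivable d2)) _.
have e1 := derive_mulmx 'e_i (dC j Ux) (dT Ux).
have e2 := derive_mulmx 'e_i (dT Ux) dCT.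
apply: etrans (congr2 +%R e1 e2) _.
by rewrite (derive_trmx 'e_i (dC j Ux)) (parallel_derive i Ux).
Qed.

(** Differentiate the equation of a parallel tensor once more: the mixed second
   derivatives agree, and what is left of their difference is the action of the
   curvature on [T]. *)
Lemma ricci_identity i j x : U x ->
  riemann_mx i j x *m T x + T x *m (riemann_mx i j x)^T = 0.
Proof.
move=> Ux; rewrite (riemann_mxE i j Ux); apply: ricci_mx.
apply: etrans (esym (second_derive i j Ux)) _.
apply: etrans (second_derive j i Ux).
exact: (smooth_mx_schwarz oU j i sT Ux).
Qed.

(** The endomorphism associated with [T] by the metric: unlike those of [T], its
   trace and the trace of its square are independent of coordinates. *)
Definition raised x : 'M[R]_m := T x *m invmx (G x).

Lemma smooth_raised : smooth_mx U raised.
Proof. exact: (smooth_mxM oU sT (smooth_inv_metric mG)). Qed.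

Let dA x : U x -> differentiable raised x.
Proof. by move=> Ux; exact: (smooth_mx_differentiable oU smooth_raised Ux). Qed.

Lemma raisedK x : U x -> raised x *m G x = T x.
Proof. by move=> Ux; case: mG => _ _ _ uG; rewrite mulmxKV ?uG. Qed.

(** A parallel endomorphism differs from a constant one by a commutator with the
   connection, which the traces of its powers do not see. *)
Lemma derive_raised k x : U x ->
  'D_'e_k raised x = conn G k x *m raised x - raised x *m conn G k x.
Proof.
move=> Ux; case: (mG) => _ sG _ uG.
have dG := smooth_mx_differentiable oU sG Ux.
apply: (can_inj (mulmxK (uG x Ux))).
have E : 'D_'e_k T x = 'D_'e_k raised x *m G x + raised x *m 'D_'e_k G x.
  apply: etrans (derive_mulmx 'e_k (dA Ux) dG).
  by apply: (derive_open_eq _ oU _ Ux) => y Uy; rewrite raisedK.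
have E2 : 'D_'e_k raised x *m G x = 'D_'e_k T x - raised x *m 'D_'e_k G x.
  by rewrite E addrK.
apply: etrans E2 _; rewrite (parallel_derive k Ux) (metric_compat mG k Ux).
exact: derive_raised_mx (raisedK Ux).
Qed.

Lemma derive_trace (A : 'rV[R]_m -> 'M[R]_m) x v : differentiable A x ->
  'D_v (fun y => \tr (A y)) x = \tr ('D_v A x).
Proof.
move=> dAx; rewrite /mxtrace derive_sum_fun; last by move=> i; exact: differentiable_entry.
by apply: eq_bigr => i _; rewrite derive_mxE.
Qed.

Lemma derive_trace_raised k x : U x -> 'D_'e_k (fun y => \tr (raised y)) x = 0.
Proof.
move=> Ux; apply: etrans (derive_trace _ (dA Ux)) _.
by rewrite (derive_raised k Ux) linearB /= mxtrace_mulC subrr.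
Qed.

Lemma derive_trace_raised_sqr k x : U x ->
  'D_'e_k (fun y => \tr (raised y *m raised y)) x = 0.
Proof.
move=> Ux; have dAA := differentiable_mulmx (dA Ux) (dA Ux).
apply: etrans (derive_trace _ dAA) _.
rewrite (derive_mulmx 'e_k (dA Ux) (dA Ux)) (derive_raised k Ux).
exact: mxtrace_commutator_sqr.
Qed.

End ParallelTensor.

(** * Linear algebra in dimension two *)

Section DimensionTwo.
Variable R : realType.
Implicit Types A G T O : 'M[R]_2.

Lemma ord2P (P : 'I_2 -> Prop) : P ord0 -> P ord_max -> forall i, P i.
Proof.
move=> P0 P1 i; case: (unliftP ord0 i) => [j ->|-> //].
by rewrite ord1 (_ : lift ord0 ord0 = ord_max) //; exact: val_inj.
Qed.

Lemma sum_ord2 (F : 'I_2 -> R) : \sum_i F i = F ord0 + F ord_max.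
Proof.
by rewrite big_ord_recl big_ord1; congr (_ + F _); exact: val_inj.
Qed.

Lemma scalar_mx2 A : A ord0 ord_max = 0 -> A ord_max ord0 = 0 ->
  A ord0 ord0 = A ord_max ord_max -> A = (\tr A / 2)%:M.
Proof.
move=> A01 A10 A00; have trA : \tr A / 2 = A ord0 ord0.
  by rewrite /mxtrace sum_ord2 -A00 -mulr2n -[A _ _ *+ 2]mulr_natr mulfK // pnatr_eq0.
apply/matrixP; apply: ord2P; apply: ord2P; rewrite mxE trA ?eqxx ?mulr1n ?mulr0n //.
Qed.

(** [O *m G] is skew, that is, a multiple of the rotation by a right angle, and
   [O *m T] is its product with [A^T].  If the multiple is not zero, skewness of
   that product forces [A] to be scalar. *)
Lemma curvature_or_scalar O G T A : T = G *m A^T ->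
  O *m G + (O *m G)^T = 0 -> O *m T + (O *m T)^T = 0 ->
  (O *m G) ord_max ord0 = 0 \/ A = (\tr A / 2)%:M.
Proof.
move=> -> skG; rewrite mulmxA; move: (O *m G) skG => S skS skSA.
have eS i j : S i j + S j i = 0 by have /matrixP/(_ i j) := skS; rewrite !mxE.
have eSA i j : S i ord0 * A j ord0 + S i ord_max * A j ord_max
    + (S j ord0 * A i ord0 + S j ord_max * A i ord_max) = 0.
  by have /matrixP/(_ i j) := skSA; rewrite !mxE !sum_ord2 !mxE.
have S00 : S ord0 ord0 = 0 by have := eS ord0 ord0; lra.
have S11 : S ord_max ord_max = 0 by have := eS ord_max ord_max; lra.
have S01 : S ord0 ord_max = - S ord_max ord0 by have := eS ord0 ord_max; lra.
have [w0|w0] := eqVneq (S ord_max ord0) 0; first by left.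
right; apply: scalar_mx2; apply: (mulfI w0).
- by have := eSA ord0 ord0; rewrite S00 S01; lra.
- by have := eSA ord_max ord_max; rewrite S11; lra.
- by have := eSA ord0 ord_max; rewrite S00 S11 S01; lra.
Qed.

(** Let [p], [q], [r], [s] be the entries of [A].  The hypothesis on the traces says
   that (p - s)^2 + 4 q r = 0.  Eliminating [r] by the symmetry of [A *m G]
   shows that the quadratic form of [G] vanishes at the vector (p - s, 2 q). *)
Lemma traceless_part_zero A G T : G^T = G -> T^T = T -> A *m G = T ->
  (forall v : 'rV[R]_2, v != 0 -> 0 < (v *m G *m v^T) ord0 ord0) ->
  \tr (A *m A) = \tr A ^+ 2 / 2 -> A = (\tr A / 2)%:M.
Proof.
move=> symG symT AG posG trA.
have eG : G ord0 ord_max = G ord_max ord0 by rewrite -{1}symG mxE.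
have eT : T ord0 ord_max = T ord_max ord0 by rewrite -{1}symT mxE.
rewrite -AG !mxE !sum_ord2 eG in eT.
rewrite /mxtrace !sum_ord2 !mxE !sum_ord2 in trA.
have g1 : 0 < G ord_max ord_max.
  have /posG : 'e_ord_max != 0 :> 'rV[R]_2.
    by apply/eqP => /rowP/(_ ord_max)/eqP; rewrite !mxE !eqxx oner_eq0.
  by rewrite !mxE !sum_ord2 !mxE !sum_ord2 !mxE !eqxx /= !(mulr0, mul0r, add0r, mulr1, mul1r).
have g0 : 0 < G ord0 ord0.
  have /posG : 'e_ord0 != 0 :> 'rV[R]_2.
    by apply/eqP => /rowP/(_ ord0)/eqP; rewrite !mxE !eqxx oner_eq0.
  by rewrite !mxE !sum_ord2 !mxE !sum_ord2 !mxE !eqxx /= !(mulr0, mul0r, addr0, mulr1, mul1r).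
pose v : 'rV[R]_2 := \row_j (if j == ord0 then A ord0 ord0 - A ord_max ord_max
                             else 2 * A ord0 ord_max).
have [v0|/posG] := eqVneq v 0.
  have u0 : A ord0 ord0 = A ord_max ord_max.
    by have /rowP/(_ ord0) := v0; rewrite !mxE /=; lra.
  have q0 : A ord0 ord_max = 0 by have /rowP/(_ ord_max) := v0; rewrite !mxE /=; lra.
  apply: scalar_mx2 => //.
  by rewrite u0 q0 in eT; apply: (mulIf (lt0r_neq0 g0)); lra.
rewrite !mxE !sum_ord2 !mxE !sum_ord2 !mxE /= eG => pos; exfalso.
move: eT trA pos; move: (A ord0 ord0) (A ord0 ord_max) (A ord_max ord0) (A ord_max ord_max).
move: (G ord0 ord0) (G ord_max ord0) (G ord_max ord_max).
move=> a b c p q r s eT trA pos.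
have : ((p - s) * a + 2 * q * b) * (p - s) + ((p - s) * b + 2 * q * c) * (2 * q) =
  a * (2 * (p * p + q * r + (r * q + s * s) - (p + s) ^+ 2 / 2))
  + 4 * q * ((p * b + q * c) - (r * a + s * b)) by field.
rewrite trA eT !subrr !mulr0 addr0 => E.
by move: pos; rewrite E ltxx.
Qed.

End DimensionTwo.

(** * From charts to the manifold *)

Lemma posdef_unitmx (R : realType) m (G : 'M[R]_m) :
  (forall v : 'rV[R]_m, v != 0 -> 0 < (v *m G *m v^T) ord0 ord0) -> G \in unitmx.
Proof.
move=> pos; rewrite unitmxE unitfE; apply/negP => /det0P[v v0 vG].
by have := pos v v0; rewrite vG mul0mx mxE ltxx.
Qed.

Lemma inner_ge0 (R : realType) m (G : 'rV[R]_m -> 'M[R]_m) x v :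
  (forall v : 'rV[R]_m, v != 0 -> 0 < (v *m G x *m v^T) ord0 ord0) -> 0 <= inner G x v v.
Proof.
move=> pos; have [->|/pos/ltW //] := eqVneq v 0.
by rewrite /inner !mul0mx mxE.
Qed.

Lemma zero_derive_locally_constant (R : realType) m (U : set 'rV[R]_m) (f : 'rV[R]_m -> R) x :
  open U -> smooth_on U f -> (forall i y, U y -> 'D_'e_i f y = 0) -> U x ->
  \forall y \near x, f y = f x.
Proof.
move=> oU sf f0 Ux.
have [d d0 dU] := near_norm (open_nbhs_nbhs (conj oU Ux)).
apply/nbhs_ballP; exists d => //= y; rewrite -ball_normE /= => xy.
pose v := y - x.
have vd (t : R) : `|t| <= `|1 : R| -> U (t *: v + x).
  move=> t1; apply: dU; rewrite normrZ; apply: le_lt_trans xy.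
  by rewrite distrC -[leRHS]mul1r ler_wpM2r // -(normr1 R).
have [|t t1 E] := @MVT_line R m f x v 1.
  by move=> t t1; apply: diff_derivable; exact: (smooth_differentiable oU sf (vd t t1)).
move: E; rewrite scale1r /v subrK => E; apply/eqP; rewrite -subr_eq0 E mul1r.
rewrite derive_dir; last exact: (smooth_differentiable oU sf (vd t t1)).
by rewrite big1 // => i _; rewrite f0 ?scaler0 //; exact: vd.
Qed.

Lemma connected_constant (T : topologicalType) (V : Type) (F : T -> V) :
  connected [set: T] -> (forall p, \forall q \near p, F q = F p) ->
  forall p q, F q = F p.
Proof.
move=> cT loc p q.
pose B := [set q | F q = F p].
have oB : open B.
  rewrite openE => x Bx; apply: filterS (loc x) => y.
  by rewrite /B /= => ->.
have cB : closed B.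
  rewrite -openC openE => x nBx; apply: filterS (loc x) => y Fyx.
  by rewrite /setC /B /= Fyx.
have BT : B = [set: T].
  apply: cT; [by exists p|exists B => //; by rewrite setTI|exists B => //; by rewrite setTI].
suff : B q by [].
by rewrite BT.
Qed.

Section Charts.
Variables (R : realType) (m : nat) (M : manifold R m).
Implicit Types (a b : chart M) (p : M).

Definition transition a b (x : 'rV[R]_m) : 'rV[R]_m := coord M b (param M a x).

Lemma chart_image_open a (O : set M) : open O -> O `<=` dom M a -> open (coord M a @` O).
Proof.
move=> oO Oa; rewrite openE => x [p Op <-].
have ax : (coord M a @` dom M a) (coord M a p) by exists p => //; exact: Oa.
have near_codom := open_nbhs_nbhs (conj (@codom_open _ _ M a) ax).
have near_O : nbhs (coord M a p) (param M a @^-1` O).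
  apply: (param_continuous ax); rewrite (coordK (Oa p Op)).
  exact: open_nbhs_nbhs.
apply: filterS (filterI near_codom near_O) => y [[q aq <-]].
by rewrite /preimage /= (coordK aq) => Oq; exists q.
Qed.

Lemma coordP a (O : set M) (P : 'rV[R]_m -> Prop) : O `<=` dom M a ->
  (forall p, O p -> param M a (coord M a p) = p -> P (coord M a p)) ->
  forall x, (coord M a @` O) x -> P x.
Proof. by move=> Oa OP x [p Op <-]; apply: OP => //; exact/coordK/Oa. Qed.

Lemma local_metric_chart (g : metric M) a U : open U -> U `<=` codom a -> local_metric U (g a).
Proof.
move=> oU Ua; split=> //.
- by move=> i j k; apply: Ck_sub Ua _; exact: metric_smooth.
- by move=> x /Ua; exact: metric_sym.
- by move=> x /Ua ax; apply: posdef_unitmx; exact: metric_posdef.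
Qed.

Lemma metric_change_chart (g : metric M) a b (O : set M) U' : open O ->
  O `<=` dom M a `&` dom M b -> open U' -> U' `<=` codom b ->
  (forall p, O p -> U' (coord M b p)) ->
  metric_change_on (coord M a @` O) U' (g a) (g b) (transition a b).
Proof.
move=> oO Oab oU' U'b OU'.
have Oa : O `<=` dom M a by move=> p /Oab[].
have oU := chart_image_open oO Oa.
split.
- by apply: local_metric_chart => // x [p /Oa ap <-]; exists p.
- exact: local_metric_chart.
- apply: (@smooth_mx_sub _ _ _ _ (coord M a @` (dom M a `&` dom M b))).
    by move=> x [p /Oab abp <-]; exists p.
  by apply/smooth_mx_row; exact: transition_smooth.
- by apply: (coordP Oa) => p Op pK; rewrite /transition pK; exact: OU'.
- apply: (coordP Oa) => p Op pK; have [ap bp] := Oab p Op.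
  by rewrite (metric_change g ap bp) /transition pK.
Qed.

End Charts.

Section MapCharts.
Variables (R : realType) (m n : nat) (M : manifold R m) (N : manifold R n).
Variables (g : metric M) (h : metric N) (phi : M -> N).
Hypothesis sphi : smooth_map phi.

Local Notation S := (stress_bienergy g h phi).

Lemma open_local (O : set M) (B : set N) : open O -> open B -> open (O `&` phi @^-1` B).
Proof.
move=> oO oB; apply: openI => //.
by apply: open_comp => // p _; case: sphi => + _; exact.
Qed.

Lemma smooth_setting_chart a b O W : open O -> O `<=` dom M a `&` phi @^-1` dom N b ->
  open W -> W `<=` codom b -> (forall p, O p -> W (coord N b (phi p))) ->
  smooth_setting (coord M a @` O) W (g a) (h b) (local_rep phi a b).
Proof.
move=> oO Oab oW Wb OW.
have Oa : O `<=` dom M a by move=> p /Oab[].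
split.
- apply: local_metric_chart; first exact: chart_image_open.
  by move=> x [p /Oa ap <-]; exists p.
- exact: local_metric_chart.
- apply: (@smooth_mx_sub _ _ _ _ (local_dom phi a b)).
    by move=> x [p /Oab abp <-]; exists p.
  by apply/smooth_mx_row; case: sphi.
- by apply: (coordP Oa) => p Op pK; rewrite /local_rep pK; exact: OW.
Qed.

(** On the overlap of the two charts of [N], this is [stress_target_change] for
   the transition map. *)
Lemma stress_bienergy_chart a b p : dom M a p -> dom N b (phi p) ->
  S a (coord M a p) = stress_bienergy_mx (g a) (h b) (local_rep phi a b) (coord M a p).
Proof.
move=> ap bp; rewrite /stress_bienergy (coordK ap).
set b0 := chart_at N (phi p).
have b0p : dom N b0 (phi p) by exact: dom_chart_at.
pose B := dom N b0 `&` dom N b.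
have oB : open B by apply: openI; exact: dom_open.
pose O := dom M a `&` phi @^-1` B.
have oO : open O by apply: open_local => //; exact: dom_open.
have Oa : O `<=` dom M a by move=> q [].
have oW : open (coord N b0 @` B) by apply: chart_image_open => // q [].
have ch : metric_change_on (coord N b0 @` B) (codom b) (h b0) (h b) (transition b0 b).
  apply: metric_change_chart => //; first exact: codom_open.
  by move=> q [_ bq]; exists q.
have st : smooth_setting (coord M a @` O) (coord N b0 @` B) (g a) (h b0) (local_rep phi a b0).
  apply: smooth_setting_chart => //.
  - by move=> q [aq []].
  - by move=> y [q [b0q _] <-]; exists q.
  - by move=> q [_ Bq]; exists (phi q).
apply/esym; apply: (stress_target_change ch st); last by exists p.
apply: (coordP Oa) => q [aq [b0q bq]] qK.
by rewrite /local_rep /transition qK (coordK b0q).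
Qed.

Lemma stress_bienergy_change a a' p : dom M a p -> dom M a' p ->
  S a (coord M a p) = jac (transition a a') (coord M a p) *m S a' (coord M a' p)
    *m (jac (transition a a') (coord M a p))^T.
Proof.
move=> ap a'p; set b := chart_at N (phi p).
have bp : dom N b (phi p) by exact: dom_chart_at.
rewrite (stress_bienergy_chart ap bp) (stress_bienergy_chart a'p bp).
pose O := (dom M a `&` dom M a') `&` phi @^-1` dom N b.
have oO : open O by apply: open_local; [apply: openI|]; exact: dom_open.
have Oa : O `<=` dom M a by move=> q [[]].
pose O' := dom M a' `&` phi @^-1` dom N b.
have oO' : open O' by apply: open_local; exact: dom_open.
have ch : metric_change_on (coord M a @` O) (coord M a' @` O') (g a) (g a') (transition a a').
  apply: metric_change_chart => //.
  - by move=> q [].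
  - by apply: chart_image_open => // q [].
  - by move=> y [q [a'q _] <-]; exists q.
  - by move=> q [[_ a'q] bq]; exists q.
have st : smooth_setting (coord M a' @` O') (codom b) (g a') (h b) (local_rep phi a' b).
  apply: smooth_setting_chart => //; first exact: codom_open.
  by move=> q [_ bq]; exists (phi q).
have pO : (coord M a @` O) (coord M a p) by exists p.
have repE x : (coord M a @` O) x -> local_rep phi a b x = local_rep phi a' b (transition a a' x).
  move: x; apply: (coordP Oa) => q [[aq a'q] bq] qK.
  by rewrite /local_rep /transition qK (coordK a'q).
have := stress_source_change ch st repE pO.
by rewrite {2}/transition (coordK ap).
Qed.

Lemma smooth_stress_bienergy a : smooth_mx (codom a) (S a).
Proof.
move=> i j k; apply: Ck_local => x [p ap <-].
pose b := chart_at N (phi p); have bp : dom N b (phi p) by exact: dom_chart_at.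
pose O := dom M a `&` phi @^-1` dom N b.
have oO : open O by apply: open_local; exact: dom_open.
have Oa : O `<=` dom M a by move=> q [].
exists (coord M a @` O); first by exists p.
have st : smooth_setting (coord M a @` O) (codom b) (g a) (h b) (local_rep phi a b).
  apply: smooth_setting_chart => //; first exact: codom_open.
  by move=> q [_ bq]; exists (phi q).
apply: (Ck_eq (chart_image_open oO Oa) _ (smooth_stress st i j k)).
by apply: (coordP Oa) => q [aq bq] _; rewrite (stress_bienergy_chart aq bq).
Qed.

Lemma stress_bienergy_sym a p : dom M a p -> (S a (coord M a p))^T = S a (coord M a p).
Proof. by move=> ap; apply: stress_sym; apply: metric_sym; exists p. Qed.

Definition raised_at a p : 'M[R]_m := raised (g a) (S a) (coord M a p).

Lemma raised_atK a p : dom M a p ->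
  raised_at a p *m g a (coord M a p) = S a (coord M a p).
Proof.
move=> ap; have mG := local_metric_chart g (@codom_open _ _ M a) (@subset_refl _ (codom a)).
have Up : codom a (coord M a p) by exists p.
exact: (raisedK (S a) mG Up).
Qed.

Lemma raised_at_change a a' p : dom M a p -> dom M a' p ->
  exists2 J : 'M[R]_m, J \in unitmx & raised_at a p = J *m raised_at a' p *m invmx J.
Proof.
move=> ap a'p; pose J := jac (transition a a') (coord M a p).
have GE : g a (coord M a p) = J *m g a' (coord M a' p) *m J^T := metric_change g ap a'p.
have uG : g a (coord M a p) \in unitmx.
  by apply: posdef_unitmx; apply: metric_posdef; exists p.
have Ju : J \in unitmx.
  by have := uG; rewrite GE !unitmxE !det_mulmx !unitrM => /andP[/andP[]].
exists J => //; apply: (can_inj (mulmxK uG)).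
rewrite (raised_atK ap) (stress_bienergy_change ap a'p) -/J -(raised_atK a'p) GE.
by move: (raised_at a' p) => A; rewrite !mulmxA mulmxKV.
Qed.

Definition raised_trace p := \tr (raised_at (chart_at M p) p).
Definition raised_trace_sqr p :=
  \tr (raised_at (chart_at M p) p *m raised_at (chart_at M p) p).

Lemma raised_traceE a p : dom M a p -> raised_trace p = \tr (raised_at a p).
Proof.
move=> ap; have [J Ju E] := raised_at_change (dom_chart_at p) ap.
by rewrite /raised_trace E mxtrace_mulC mulKmx.
Qed.

Lemma raised_trace_sqrE a p : dom M a p ->
  raised_trace_sqr p = \tr (raised_at a p *m raised_at a p).
Proof.
move=> ap; have [J Ju E] := raised_at_change (dom_chart_at p) ap.
rewrite /raised_trace_sqr E; move: (raised_at a p) => A.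
by rewrite !mulmxA mulmxKV // mxtrace_mulC !mulmxA mulVmx // mul1mx.
Qed.

(** The trace of the stress-energy tensor: in dimension [m = 2] the term in the
   pairing disappears and the squared norm of the tension is left. *)
Lemma stress_trace_inner x (G : 'rV[R]_m -> 'M[R]_m) (H : 'rV[R]_n -> 'M[R]_n) f :
  (G x)^T = G x -> G x \in unitmx ->
  \tr (stress_bienergy_mx G H f x *m invmx (G x)) =
    inner H (f x) (tension G H f x) (tension G H f x) * (m%:R / 2)
    + (m%:R - 2) * \tr ((invmx (G x))^T *m stress_pairing G H f x).
Proof.
move=> symG uG; rewrite stressE; move: (stress_pairing G H f x) => B.
rewrite !mulmxBl -scalemxAl mulmxV // !raddfB /= linearZ /= mxtrace1.
rewrite [in RHS]mxtrace_mulC -[\tr (B^T *m _)]mxtrace_tr trmx_mul trmxK.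
rewrite (mxtrace_mulC _ B) trmx_inv symG; ring.
Qed.

Section Parallel.
Hypothesis parS : parallel g S.

Let mG a : local_metric (codom a) (g a).
Proof. exact: (local_metric_chart g (@codom_open _ _ M a) (@subset_refl _ (codom a))). Qed.

(** In a chart, both traces are smooth functions with vanishing partial
   derivatives. *)
Lemma raised_traces_locally_constant p :
  \forall q \near p, raised_trace q = raised_trace p /\ raised_trace_sqr q = raised_trace_sqr p.
Proof.
pose a := chart_at M p; have ap : dom M a p by exact: dom_chart_at.
have ap' : codom a (coord M a p) by exists p.
have oU : open (codom a) by exact: codom_open.
have sA : smooth_mx (codom a) (raised (g a) (S a)).
  exact: (smooth_raised (mG a) (smooth_stress_bienergy a)).
have str : smooth_on (codom a) (fun x => \tr (raised (g a) (S a) x)).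
  by apply: (smooth_sum oU) => i; exact: sA.
have str2 : smooth_on (codom a) (fun x => \tr (raised (g a) (S a) x *m raised (g a) (S a) x)).
  by apply: (smooth_sum oU) => i; exact: (smooth_mxM oU sA sA).
have parSa k x : codom a x -> nabla2 (g a) (S a) k x = 0 by exact: parS.
have d1 i y (Uy : codom a y) :=
  derive_trace_raised (mG a) (smooth_stress_bienergy a) parSa i Uy.
have d2 i y (Uy : codom a y) :=
  derive_trace_raised_sqr (mG a) (smooth_stress_bienergy a) parSa i Uy.
have near1 := coord_continuous ap (zero_derive_locally_constant oU str d1 ap').
have near2 := coord_continuous ap (zero_derive_locally_constant oU str2 d2 ap').
have neara := open_nbhs_nbhs (conj (@dom_open _ _ M a) ap).
apply: filterS (filterI neara (filterI near1 near2)) => q [aq [c1 c2]].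
rewrite (raised_traceE aq) (raised_traceE ap) (raised_trace_sqrE aq) (raised_trace_sqrE ap).
by split; [exact: c1|exact: c2].
Qed.

End Parallel.

End MapCharts.

(** * Maps from a surface with parallel stress-energy tensor *)

Lemma gauss_curvature_zero (R : realType) (M : manifold R 2) (g : metric M) p :
  (riemann_mx (g (chart_at M p)) ord0 ord_max (coord M (chart_at M p) p)
     *m g (chart_at M p) (coord M (chart_at M p) p)) ord_max ord0 = 0 ->
  gauss_curvature g p = 0.
Proof.
rewrite /gauss_curvature; set G := g _; set x := coord _ _ _ => E.
have curvE : curvature G x 'e_ord0 'e_ord_max 'e_ord_max
    = row ord_max (riemann_mx G ord0 ord_max x).
  apply/rowP => l; rewrite !mxE; move: (riemann G x) => r.
  rewrite !sum_ord2 !mxE !eqxx /=.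
  by rewrite !(mulr0, mul0r, mulr1, addr0, add0r).
have -> : inner G x (curvature G x 'e_ord0 'e_ord_max 'e_ord_max) 'e_ord0 = 0.
  rewrite curvE /inner -row_mul -[RHS]E [LHS]mxE sum_ord2 !mxE !eqxx /=.
  by rewrite mulr1 mulr0 addr0.
by rewrite mul0r.
Qed.

Section Surface.
Variables (R : realType) (n : nat) (M : manifold R 2) (g : metric M).
Variables (N : manifold R n) (h : metric N) (phi : M -> N).
Hypothesis cM : connected [set: M].
Hypothesis sphi : smooth_map phi.
Hypothesis parS : parallel g (stress_bienergy g h phi).

Local Notation S := (stress_bienergy g h phi).

Lemma tension_norm_sqr p : tension_norm g h phi p ^+ 2 = raised_trace g h phi p.
Proof.
have ap := dom_chart_at p; have bp := dom_chart_at (phi p).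
rewrite /tension_norm sqr_sqrtr; last first.
  by apply: inner_ge0; apply: metric_posdef; exists (phi p).
have Up : codom (chart_at M p) (coord M (chart_at M p) p) by exists p.
rewrite /raised_trace /raised_at /raised (stress_bienergy_chart _ _ sphi ap bp).
rewrite stress_trace_inner; [|exact: metric_sym|exact/posdef_unitmx/metric_posdef].
by rewrite subrr mul0r addr0 divff ?pnatr_eq0 // mulr1 /local_rep (coordK ap).
Qed.

Lemma traces_constant p q :
  raised_trace g h phi q = raised_trace g h phi p /\
  raised_trace_sqr g h phi q = raised_trace_sqr g h phi p.
Proof.
pose F q := (raised_trace g h phi q, raised_trace_sqr g h phi q).
have loc r : \forall s \near r, F s = F r.
  apply: filterS (raised_traces_locally_constant sphi parS r) => s [e1 e2].
  by rewrite /F e1 e2.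
by have [-> ->] := connected_constant cM loc p q.
Qed.

Lemma tension_norm_constant p q : tension_norm g h phi q = tension_norm g h phi p.
Proof.
have norm_inj (s t : R) : 0 <= s -> 0 <= t -> s ^+ 2 = t ^+ 2 -> s = t.
  by move=> s0 t0 /eqP; rewrite eqrXn2 // => /eqP.
apply: norm_inj; [exact: sqrtr_ge0|exact: sqrtr_ge0|].
by apply: etrans (tension_norm_sqr q) _; rewrite tension_norm_sqr; have [] := traces_constant p q.
Qed.

(** The Ricci identity applies both to the stress-energy tensor and to the metric,
   which is parallel. *)
Lemma raised_scalar_or_flat p : let a := chart_at M p in
  gauss_curvature g p = 0 \/
  raised_at g h phi a p = (\tr (raised_at g h phi a p) / 2)%:M.
Proof.
move=> a; have ap : dom M a p by exact: dom_chart_at.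
have Up : codom a (coord M a p) by exists p.
have oU : open (codom a) by exact: codom_open.
have mG := local_metric_chart g oU (@subset_refl _ (codom a)).
have [_ sG _ _] := mG.
have sT := smooth_stress_bienergy g h sphi a.
have parT k x : codom a x -> nabla2 (g a) (S a) k x = 0 by exact: parS.
have parG k x : codom a x -> nabla2 (g a) (g a) k x = 0.
  move=> Ux; rewrite nabla2E; last exact: (smooth_mx_differentiable oU sG Ux).
  by rewrite (metric_compat mG k Ux) addrAC addrK subrr.
have skewG := ricci_identity mG sG parG ord0 ord_max Up.
have skewT := ricci_identity mG sT parT ord0 ord_max Up.
have symG := metric_sym g Up.
have symT := stress_bienergy_sym g h phi ap.
have TE : S a (coord M a p) = g a (coord M a p) *m (raised_at g h phi a p)^T.
  by rewrite -symT -(raised_atK g h phi ap) trmx_mul symG.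
rewrite -{2}symG -trmx_mul in skewG; rewrite -{2}symT -trmx_mul in skewT.
have [K0|AE] := curvature_or_scalar TE skewG skewT; last by right.
by left; exact: gauss_curvature_zero.
Qed.

Lemma raised_scalar a p : dom M a p ->
  raised_trace_sqr g h phi p = raised_trace g h phi p ^+ 2 / 2 ->
  S a (coord M a p) = (tension_norm g h phi p ^+ 2 / 2) *: g a (coord M a p).
Proof.
move=> ap; rewrite (raised_trace_sqrE g h sphi ap) (raised_traceE g h sphi ap) => trE.
have Up : codom a (coord M a p) by exists p.
have AG := raised_atK g h phi ap.
have := traceless_part_zero (metric_sym g Up) (stress_bienergy_sym g h phi ap) AG
  (metric_posdef g Up) trE.
rewrite tension_norm_sqr (raised_traceE g h sphi ap) => AE.
by rewrite -AG {1}AE mul_scalar_mx.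
Qed.

End Surface.

Theorem corollary1 (R : realType) (n : nat)
    (M : manifold R 2) (g : metric M) (N : manifold R n) (h : metric N)
    (v_g : {measure set (borel M) -> \bar R}) (phi : M -> N) :
  riemannian_volume g v_g ->
  connected [set: M] ->
  compact [set: M] ->
  smooth_map phi ->
  biharmonic g h phi ->
  parallel g (stress_bienergy g h phi) ->
  (exists c : R, forall p : M, tension_norm g h phi p = c) /\
  ((\int[v_g]_p (gauss_curvature g p)%:E)%E = 0%E \/
   forall (a : chart M) (p : M), dom M a p ->
     stress_bienergy g h phi a (coord M a p) =
       (tension_norm g h phi p ^+ 2 / 2) *: g a (coord M a p)).
Proof.
move=> _ cM _ sphi _ parS; split.
  by exists (tension_norm g h phi point) => p; exact: tension_norm_constant.
(* either K vanishes identically or A is scalar at some p0, hence everywhere *)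
have [flat|/existsNP[p0 curved]] := pselect (forall p, gauss_curvature g p = 0).
  by left; apply: integral0_eq => p _; rewrite flat.
right=> a p ap; apply: raised_scalar => //.
have [-> ->] := traces_constant cM sphi parS p0 p.
have [//|AE] := raised_scalar_or_flat sphi parS p0.
have ap0 := dom_chart_at p0.
rewrite (raised_trace_sqrE g h sphi ap0) (raised_traceE g h sphi ap0).
set A := raised_at _ _ _ _ _ in AE *.
rewrite {1 2}AE -scalar_mxM mxtrace_scalar -mulr_natr expr2.
by field.
Qed.
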